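(* Let $G=\langle\sigma,\tau\rangle$ be the Klein four-group, let $\Bbbk$ be a field of characteristic $2$, and let $\chi=\{\langle\sigma\rangle,\langle\tau\rangle,\langle\sigma\tau\rangle\}$. Let $N\cong V_{-(2n+1)}$ where $n\ge1$. Then for every integer $i\ge0$, $$\dim H^i_\chi(G,N)=\begin{cases} n+1-2i & i\le n/2,\\ \max(0,2i-n-3)& i>n/2.\end{cases}$$
   Context: All modules are finitely generated. Put $X=\sigma-1$, $Y=\tau-1\in\Bbbk G$, so $\Bbbk G\cong\Bbbk[X,Y]/(X^2,Y^2)$. For $n\ge0$, $V_{-(2n+1)}$ is the $(2n+1)$-dimensional module with basis $a_1,\dots,a_n,b_0,\dots,b_n$ and $Xa_i=b_{i-1}$, $Ya_i=b_i$ ($1\le i\le n$), $Xb_i=Yb_i=0$. A $\Bbbk G$-module $M$ is projective relative to $\chi$ if it is a direct summand of $\bigoplus_{H\in\chi} M\downarrow_H\uparrow^G$. Relative cohomology $H^i_\chi(G,N)=\mathrm{Ext}^i_{\Bbbk G,\chi}(\Bbbk,N)$ is the $i$-th homology of the complex $0\to\mathrm{Hom}_{\Bbbk G}(Q_0,N)\to\mathrm{Hom}_{\Bbbk G}(Q_1,N)\to\cdots$, where $\cdots\to Q_1\to Q_0\to\Bbbk\to 0$ is a relative projective resolution of the trivial module: an exact complex in which each $Q_i$ is projective relative to $\chi$ and the connecting homomorphisms split over each $H\in\chi$ (i.e. the complex is split exact on restriction to each $H\in\chi$). It is independent of the choice of resolution. *)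

(* Defs.v *)
From mathcomp Require Import all_boot all_fingroup all_algebra all_solvable.
From mathcomp Require Import mxrepresentation character.

Set Implicit Arguments.
Unset Strict Implicit.
Unset Printing Implicit Defensive.

Import GRing.Theory.
Local Open Scope ring_scope.

(* A finitely generated kG-module is a [representation F G] (its degree
   [rdegree] together with an [mx_representation F G] of that degree).  The
   module is the space of row vectors, on which g acts by v |-> v *m M g, and a
   linear map f is the matrix of v |-> v *m f.  Modules are therefore right
   modules; they correspond to left modules through g |-> g^-1, which is the
   identity on an elementary abelian 2-group. *)

Section Modules.

Variables (F : fieldType) (gT : finGroupType).

Definition hom_on (G : {group gT}) (A : {set gT}) (V W : representation F G)
    (f : 'M[F]_(rdegree V, rdegree W)) : Prop :=
  forall g, g \in A -> V g *m f = f *m W g.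

Definition homG (G : {group gT}) (V W : representation F G) :
    {vspace 'M[F]_(rdegree V, rdegree W)} :=
  (\bigcap_(g in G) lker (linfun (mulmx (V g) \- mulmxr (W g))))%VS.

Lemma homGP (G : {group gT}) (V W : representation F G) f :
  reflect (hom_on G f) (f \in homG V W).
Proof.
apply: (iffP idP) => [/subv_bigcapP Hf g Gg | Hf].
  by have := Hf g Gg; rewrite -memvE memv_ker lfunE /= subr_eq0 => /eqP.
apply/subv_bigcapP => g Gg.
by rewrite -memvE memv_ker lfunE /= subr_eq0 Hf.
Qed.

Lemma triv_mx_repr (G : {group gT}) :
  mx_repr G (fun _ : gT => 1%:M : 'M[F]_1).
Proof. by split=> // x y _ _; rewrite mulmx1. Qed.

Definition triv_repr (G : {group gT}) : representation F G :=
  Representation (MxRepresentation (triv_mx_repr G)).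

End Modules.

Section Induction.

Variables (F : fieldType) (gT : finGroupType) (G H : {group gT}).
Hypothesis sHG : H \subset G.
Variables (m : nat) (rH : mx_representation F H m).

Definition transv (i : 'I_#|rcosets H G|) : gT := repr (enum_val i).

(* W (x)_{kH} kG, with blocks W (x) t_i indexed by a transversal (t_i) of the
   right cosets of H in G: (w (x) t_i) g = w h (x) t_j when t_i g = h t_j with
   h in H. *)
Definition ind_mx (g : gT) : 'M[F]_(\sum_(i < #|rcosets H G|) m) :=
  \mxblock_(i < #|rcosets H G|, j < #|rcosets H G|)
    (let h := (transv i * g * (transv j)^-1)%g in
     if h \in H then rH h else 0 : 'M[F]_m).

Lemma transvE i : (H :* transv i)%g = enum_val i.
Proof.
rewrite /transv; have /rcosetsP[x _ ->] := enum_valP i.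
by rewrite rcoset_repr.
Qed.

Lemma transvG i : transv i \in G.
Proof.
have /rcosetsP[x Gx Ci] := enum_valP i.
have : transv i \in (H :* x)%g by rewrite -Ci -transvE rcoset_refl.
by case/rcosetP => h Hh ->; rewrite groupM // (subsetP sHG).
Qed.

Lemma transv_ex g : g \in G -> exists j, (g * (transv j)^-1)%g \in H.
Proof.
move=> Gg; have CG : (H :* g)%g \in rcosets H G by apply/rcosetsP; exists g.
exists (enum_rank_in CG (H :* g)%g).
rewrite -mem_rcoset transvE enum_rankK_in // rcoset_refl //.
Qed.

Lemma transv_inj i j : (transv i * (transv j)^-1)%g \in H -> i = j.
Proof.
rewrite -mem_rcoset => Hij; apply: enum_val_inj.
by rewrite -!transvE; apply/rcoset_eqP.
Qed.

Lemma ind_mx_repr : mx_repr G ind_mx.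
Proof.
split=> [|x y Gx Gy].
  rewrite /ind_mx -mxdiagZ; apply/eq_mxblockP => i j.
  rewrite mulg1; case: eqVneq => [<- | neq_ij].
    by rewrite mulgV group1 repr_mx1 conform_mx_id.
  by case: ifP => // /transv_inj /eqP; rewrite (negPf neq_ij).
rewrite /ind_mx mul_mxblock; apply/eq_mxblockP => i j.
have [k Hk] := transv_ex (groupM (transvG i) Gx).
rewrite (bigD1 k) //= Hk big1 ?addr0 => [|l neq_lk]; last first.
  case: ifP => [Hl | _]; last by rewrite mul0mx.
  case/eqP: neq_lk; apply: transv_inj.
  have := groupM (groupVr Hl) Hk.
  by rewrite !invMg invgK !mulgA !mulgVK.
have -> : (transv i * (x * y) * (transv j)^-1 =
          (transv i * x * (transv k)^-1) * (transv k * y * (transv j)^-1))%g.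
  by rewrite !mulgA mulgVK.
rewrite groupMl //; case: ifP => [Hj | _]; last by rewrite mulmx0.
by rewrite repr_mxM.
Qed.

Definition ind_repr : representation F G :=
  Representation (MxRepresentation ind_mx_repr).

End Induction.

Section RelativeCohomology.

Variables (F : fieldType) (gT : finGroupType) (G : {group gT}).

Definition subgroup_of := {H : {group gT} | H \subset G}.

Variable chi : {set subgroup_of}.

Definition resind (M : representation F G) (H : subgroup_of) :
    representation F G :=
  ind_repr (valP H) (subg_repr M (valP H)).

Definition direct_summand (M W : representation F G) : Prop :=
  exists C : representation F G, mx_rsim (dadd_grepr M C) W.

Definition rel_projective (M : representation F G) : Prop :=
  direct_summand M (\big[dadd_grepr/grepr0]_(H in chi) resind M H).

(* A map splits over H when it has an H-equivariant generalised inverse; for the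
   maps of an exact complex this says that the complex is split exact on
   restriction to H. *)
Definition splits_over (H : {group gT}) (V W : representation F G)
    (f : 'M[F]_(rdegree V, rdegree W)) : Prop :=
  exists2 u : 'M[F]_(rdegree W, rdegree V), hom_on H u & f *m u *m f = f.

Record rel_resolution (M : representation F G) := RelResolution {
  res_obj : nat -> representation F G;
  res_d : forall i, 'M[F]_(rdegree (res_obj i.+1), rdegree (res_obj i));
  res_aug : 'M[F]_(rdegree (res_obj 0), rdegree M);
  res_proj : forall i, rel_projective (res_obj i);
  res_d_hom : forall i, hom_on G (res_d i);
  res_aug_hom : hom_on G res_aug;
  res_aug_onto : row_full res_aug;
  res_exact0 : (kermx res_aug :=: res_d 0)%MS;
  res_exact : forall i, (kermx (res_d i) :=: res_d i.+1)%MS;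
  res_aug_split : forall H, H \in chi -> splits_over (val H) res_aug;
  res_d_split : forall H, H \in chi -> forall i, splits_over (val H) (res_d i)
}.

Section Cochains.

Variables (M : representation F G) (Q : rel_resolution M).
Variable N : representation F G.

Definition coboundary_map i :
    'Hom('M[F]_(rdegree (res_obj Q i), rdegree N),
         'M[F]_(rdegree (res_obj Q i.+1), rdegree N)) :=
  linfun (mulmx (res_d Q i)).

Definition cocycles i : {vspace 'M[F]_(rdegree (res_obj Q i), rdegree N)} :=
  (homG (res_obj Q i) N :&: lker (coboundary_map i))%VS.

Definition coboundaries i :
    {vspace 'M[F]_(rdegree (res_obj Q i), rdegree N)} :=
  match i with
  | 0 => 0%VS
  | j.+1 => (coboundary_map j @: homG (res_obj Q j) N)%VS
  end.

Lemma coboundaries_sub i : (coboundaries i <= cocycles i)%VS.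
Proof.
case: i => [|i]; first exact: sub0v.
apply/subvP => _ /memv_imgP[f /homGP Hf ->]; rewrite memv_cap; apply/andP; split.
  apply/homGP => g Gg; rewrite lfunE /= mulmxA (res_d_hom Q i Gg).
  by rewrite -!mulmxA Hf.
rewrite memv_ker !lfunE /= mulmxA.
suff -> : res_d Q i.+1 *m res_d Q i = 0 by rewrite mul0mx.
by apply/sub_kermxP; rewrite (res_exact Q i).
Qed.

Definition rel_ext_dim i : nat := \dim (cocycles i) - \dim (coboundaries i).

End Cochains.

End RelativeCohomology.

Section Klein.

Variables (F : fieldType) (gT : finGroupType) (G : {group gT}) (s t : gT).

Definition klein_four : Prop :=
  [/\ (2.-abelem G)%g, #|G| = 4%N & <<[set s; t]>>%g = G].

Definition klein_chi : {set subgroup_of G} :=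
  [set H | val H \in [:: <[s]>%G; <[t]>%G; <[s * t]>%G]].

Hypotheses (kleinG : klein_four) (char2 : 2%N \in [pchar F]).

Variable n : nat.

(* In the basis a_1, ..., a_n, b_0, ..., b_n; row i < n of the first block is
   the image of a_(i+1). *)
Definition VnegX : 'M[F]_(n + n.+1) :=
  block_mx 0 (\matrix_(i < n, j < n.+1) (j == i :> nat)%:R) 0 0.

Definition VnegY : 'M[F]_(n + n.+1) :=
  block_mx 0 (\matrix_(i < n, j < n.+1) (j == i.+1 :> nat)%:R) 0 0.

Definition Vneg_mx (g : gT) : 'M[F]_(n + n.+1) :=
  (if g \in [:: s; s * t]%g then 1%:M + VnegX else 1%:M) *m
  (if g \in [:: t; s * t]%g then 1%:M + VnegY else 1%:M).

Lemma klein_elts : [/\ G = [set 1; s; t; s * t]%g :> {set gT},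
  (s * s = 1 /\ t * t = 1 /\ t * s = s * t)%g & uniq [:: 1; s; t; s * t]%g].
Proof.
case: kleinG => abG oG genG.
have Gs : s \in G by rewrite -genG mem_gen ?set21.
have Gt : t \in G by rewrite -genG mem_gen ?set22.
have [cGG sq] := abelemP (isT : prime 2) abG.
have ss : (s * s = 1)%g by rewrite -[RHS](sq s Gs) expgS expg1.
have tt : (t * t = 1)%g by rewrite -[RHS](sq t Gt) expgS expg1.
have ts : (t * s = s * t)%g := centsP cGG t Gt s Gs.
have tst x : (t * (s * x) = s * (t * x))%g by rewrite !mulgA ts.
have ttx x : (t * (t * x) = x)%g by rewrite mulgA tt mul1g.
have ssx x : (s * (s * x) = x)%g by rewrite mulgA ss mul1g.
have E : G = [set 1; s; t; s * t]%g :> {set gT}.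
  apply/eqP; rewrite eqEsubset; apply/andP; split; last first.
    by apply/subsetP => x; rewrite !inE -!orbA => /or4P[]/eqP->; rewrite ?groupM.
  have gS : group_set [set 1; s; t; s * t]%g.
    apply/group_setP; split; first by rewrite !inE eqxx.
    move=> x y; rewrite !inE -!orbA => /or4P[]/eqP-> /or4P[]/eqP->;
      by rewrite ?mulg1 ?mul1g -?mulgA ?ts ?tst ?ttx ?ssx ?ss ?tt ?mulg1 ?eqxx ?orbT.
  rewrite -genG (gen_subG _ (Group gS)).
  by apply/subsetP => x; rewrite !inE => /orP[]/eqP->; rewrite eqxx ?orbT.
split=> //.
apply/card_uniqP; rewrite /= -oG E.
by apply: eq_card => x; rewrite !inE -!orbA.
Qed.

Lemma Vneg_mx_s : Vneg_mx s = 1%:M + VnegX.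
Proof.
have [_ _] := klein_elts; rewrite /= !inE !negb_or.
case/and4P=> _ /andP[nst nsst] _ _.
by rewrite /Vneg_mx !inE eqxx (negPf nst) (negPf nsst) mulmx1.
Qed.

Lemma Vneg_mx_t : Vneg_mx t = 1%:M + VnegY.
Proof.
have [_ _] := klein_elts; rewrite /= !inE !negb_or.
case/and4P=> _ /andP[nst _] ntst _.
by rewrite /Vneg_mx !inE eqxx eq_sym (negPf nst) (negPf ntst) mul1mx.
Qed.

Lemma Vneg_mx_repr : mx_repr G Vneg_mx.
Proof.
have [E [ss [tt ts]] U] := klein_elts.
have tst x : (t * (s * x) = s * (t * x))%g by rewrite !mulgA ts.
have ttx x : (t * (t * x) = x)%g by rewrite mulgA tt mul1g.
have ssx x : (s * (s * x) = x)%g by rewrite mulgA ss mul1g.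
have dbl (A : 'M[F]_(n + n.+1)) : A + A = 0.
  by rewrite -mulr2n -scaler_nat (pcharf0 char2) scale0r.
have XX : VnegX *m VnegX = 0.
  by rewrite mulmx_block !(mulmx0, mul0mx, addr0) block_mx0.
have YY : VnegY *m VnegY = 0.
  by rewrite mulmx_block !(mulmx0, mul0mx, addr0) block_mx0.
have XY : VnegX *m VnegY = 0.
  by rewrite mulmx_block !(mulmx0, mul0mx, addr0) block_mx0.
have YX : VnegY *m VnegX = 0.
  by rewrite mulmx_block !(mulmx0, mul0mx, addr0) block_mx0.
move: U; rewrite /= !inE !negb_or.
case/and4P=> /and3P[n1s n1t n1st] _ _ _.
have r1 : Vneg_mx 1 = 1%:M.
  by rewrite /Vneg_mx !inE (negPf n1s) (negPf n1t) (negPf n1st) mulmx1.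
have rs := Vneg_mx_s; have rt := Vneg_mx_t.
have rst : Vneg_mx (s * t) = 1%:M + VnegX + VnegY.
  by rewrite /Vneg_mx !inE eqxx !orbT mulmxDl mul1mx mulmxDr XY mulmx1 addr0
     addrAC.
split=> // x y; rewrite E !inE -!orbA => /or4P[]/eqP-> /or4P[]/eqP->;
  rewrite ?mulg1 ?mul1g -?mulgA ?ts ?tst ?ttx ?ssx ?ss ?tt ?mulg1 ?r1 ?rs ?rt
          ?rst ?mul1mx ?mulmx1 //;
  rewrite ?(mulmxDl, mulmxDr) ?mulmx1 ?mul1mx ?XX ?YY ?XY ?YX ?addr0.
all: set A := 1%:M; move: VnegX VnegY A dbl => B C A dbl.
all: have cK (Z W : 'M[F]_(n + n.+1)) : Z + W + W = Z
       by rewrite -addrA dbl addr0.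
all: by rewrite ?(addrAC A C B) ?(addrAC (A + B) C B) ?cK.
Qed.

Definition Vneg : mx_representation F G (n + n.+1) :=
  MxRepresentation Vneg_mx_repr.

End Klein.

(* Main.v *)
Require Import Defs.
From HB Require Import structures.
From mathcomp Require Import all_boot all_fingroup all_algebra all_solvable.
From mathcomp Require Import mxrepresentation character zify.

Set Implicit Arguments.
Unset Strict Implicit.
Unset Printing Implicit Defensive.

Import GRing.Theory.
Local Open Scope ring_scope.

(** The cohomology in question is computed from one explicit relative projective
    resolution of the trivial module, whose syzygies are known.

    Write V_m for the module with basis a_1, ..., a_m, b_0, ..., b_m, so that
    V_0 is trivial.  For each m there is an exact sequence

      0 -> V_(m+2) -> P_m -> V_m -> 0

    that splits over each of the three subgroups H of order two, with P_m the
    direct sum of a free module of rank m and the three permutation modules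
    k[G/H].  The free module covers the a's; the generator of k[G/H] goes to
    a vector of the span of the b's outside the image of h - 1, for h the
    generator of H.  Restricted to H, the module V_m is free on the a's plus
    one trivial summand spanned by that vector, hence the section over H
    (direction_split, cover_split).  The kernel consists of the kernel of a map
    of rank m + 1 in the middle layer, of dimension m + 2, and of the whole
    bottom layer, of dimension m + 3; syz_map is an explicit identification with
    V_(m+2) (syz_map_hom, syz_cover, syz_map_free).  So the i-th relative syzygy
    of k is V_(2i).

    Splicing these sequences gives a resolution Q (splice) for which

      dim H^(i+1) = dim Hom(V_(2i+2), N)
                    - (dim Hom(P_(2i), N) - dim Hom(V_(2i), N)).

    With N = V_n, a homomorphism V_m -> V_n is an arbitrary map from the a's to
    the b's together with a map of Kronecker modules.  The latter is
    multiplication by a polynomial of degree at most n - m, once the a's and b's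
    are read as monomials on which X acts as the identity and Y as the variable
    (toep_unique).  This gives m(n+1) + max(0, n+1-m) for the dimension
    (dim_hom_vneg); a homomorphism from P_m is an arbitrary choice of images of
    its free generators and of three vectors in the span of the b's
    (dim_hom_cover).

    An arbitrary resolution gives the same dimensions by the comparison theorem
    (comparison, rel_ext_dim_indep).  It rests on the fact that relative
    projectivity is the lifting property against maps that split over each
    H in chi, proved through Frobenius reciprocity (ind_extP,
    rel_projective_lifts, lifts_rel_projective). *)

(** * Equivariant maps and direct summands *)

Section EquivariantMaps.

Variables (F : fieldType) (gT : finGroupType) (G : {group gT}).
Implicit Types (A B : {set gT}) (V W U : representation F G).

Lemma hom_onS A B V W (f : 'M_(rdegree V, rdegree W)) :
  A \subset B -> hom_on B f -> hom_on A f.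
Proof. by move=> /subsetP sAB Hf g /sAB; apply: Hf. Qed.

Lemma hom_onM A V W U (f : 'M_(rdegree V, rdegree W))
    (h : 'M_(rdegree W, rdegree U)) :
  hom_on A f -> hom_on A h -> hom_on A (f *m h).
Proof. by move=> Hf Hh g Ag; rewrite mulmxA Hf // -!mulmxA Hh. Qed.

Lemma hom_on1 A V : @hom_on _ _ _ A V V 1%:M.
Proof. by move=> g _; rewrite mulmx1 mul1mx. Qed.

Lemma hom_on0 A V W : @hom_on _ _ _ A V W 0.
Proof. by move=> g _; rewrite mulmx0 mul0mx. Qed.

Lemma hom_onD A V W (f h : 'M_(rdegree V, rdegree W)) :
  hom_on A f -> hom_on A h -> hom_on A (f + h).
Proof. by move=> Hf Hh g Ag; rewrite mulmxDr mulmxDl Hf ?Hh. Qed.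

Lemma hom_onB A V W (f h : 'M_(rdegree V, rdegree W)) :
  hom_on A f -> hom_on A h -> hom_on A (f - h).
Proof. by move=> Hf Hh g Ag; rewrite mulmxBr mulmxBl Hf ?Hh. Qed.

Lemma hom_on_col A V W U (f : 'M_(rdegree V, rdegree U))
    (h : 'M_(rdegree W, rdegree U)) :
  @hom_on _ _ _ A (dadd_grepr V W) U (col_mx f h) <->
  hom_on A f /\ hom_on A h.
Proof.
split=> [Hfh | [Hf Hh] g Ag]; last first.
  by rewrite /= mul_block_col mul_col_mx !mul0mx addr0 add0r Hf ?Hh.
split=> g Ag; have := Hfh g Ag;
  by rewrite /= mul_block_col mul_col_mx !mul0mx addr0 add0r => /eq_col_mx[].
Qed.

Lemma hom_on_row A V W U (f : 'M_(rdegree U, rdegree V))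
    (h : 'M_(rdegree U, rdegree W)) :
  @hom_on _ _ _ A U (dadd_grepr V W) (row_mx f h) <->
  hom_on A f /\ hom_on A h.
Proof.
split=> [Hfh | [Hf Hh] g Ag]; last first.
  by rewrite /= mul_row_block mul_mx_row !mulmx0 addr0 add0r Hf ?Hh.
split=> g Ag; have := Hfh g Ag;
  by rewrite /= mul_row_block mul_mx_row !mulmx0 addr0 add0r => /eq_row_mx[].
Qed.

Lemma hom_on_dadd_l A V W U (f : 'M_(rdegree (dadd_grepr V W), rdegree U)) :
  hom_on A f -> hom_on A (usubmx f : 'M_(rdegree V, rdegree U)).
Proof. by rewrite -{1}[f](@vsubmxK _ (rdegree V)) => /hom_on_col[]. Qed.

Lemma hom_on_dadd_r A V W U (f : 'M_(rdegree (dadd_grepr V W), rdegree U)) :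
  hom_on A f -> hom_on A (dsubmx f : 'M_(rdegree W, rdegree U)).
Proof. by rewrite -{1}[f](@vsubmxK _ (rdegree V)) => /hom_on_col[]. Qed.

Lemma hom_on_gen A V W (f : 'M_(rdegree V, rdegree W)) :
  <<A>>%g \subset G -> hom_on A f -> hom_on <<A>>%g f.
Proof.
move=> sAG Hf.
pose K := [set g in G | V g *m f == f *m W g].
have gK : group_set K.
  apply/group_setP; split=> [|x y].
    by rewrite inE group1 !repr_mx1 mul1mx mulmx1 eqxx.
  rewrite !inE => /andP[Gx /eqP Ex] /andP[Gy /eqP Ey].
  by rewrite groupM // !repr_mxM // -mulmxA Ey !mulmxA Ex eqxx.
have sAK : <<A>>%g \subset Group gK.
  rewrite gen_subG; apply/subsetP=> g Ag; rewrite inE Hf // eqxx andbT.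
  exact: (subsetP sAG) (mem_gen Ag).
by move=> g /(subsetP sAK); rewrite inE => /andP[_ /eqP].
Qed.

(** A direct summand is the same thing as a retract: the complement is the
    kernel of the retraction. *)
Lemma direct_summandP V W :
  direct_summand V W <->
  exists f : 'M_(rdegree V, rdegree W), exists2 h : 'M_(rdegree W, rdegree V),
    hom_on G f /\ hom_on G h & f *m h = 1%:M.
Proof.
split=> [[C /mx_rsim_sym/mx_rsim_def[B [B' B'B defW]]] | [f [h [Hf Hh] fh]]].
  have HB' : @hom_on _ _ _ G (dadd_grepr V C) W B'.
    by move=> g Gg; rewrite (defW g Gg) !mulmxA B'B mul1mx.
  have BB' : B *m B' = 1%:M.
    by have := defW 1%g (group1 G); rewrite !repr_mx1 mulmx1 => <-.
  have HB : @hom_on _ _ _ G W (dadd_grepr V C) B.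
    by move=> g Gg; rewrite (defW g Gg) -!mulmxA B'B mulmx1.
  rewrite -[B](@hsubmxK _ _ (rdegree V)) in HB B'B.
  rewrite -[B'](@vsubmxK _ (rdegree V)) in HB' B'B.
  have [Hf _] := (hom_on_col _ _ _).1 HB'.
  have [Hh _] := (hom_on_row _ _ _).1 HB.
  exists (usubmx B'), (lsubmx B); first by [].
  by move: B'B; rewrite mul_col_row scalar_mx_block => /eq_block_mx[].
have modK : mxmodule W (kermx h).
  apply/mxmoduleP=> g Gg; apply/sub_kermxP.
  by rewrite -mulmxA Hh // mulmxA mulmx_ker mul0mx.
exists (Representation (submod_repr modK)).
have [k [kh k_inj k_hom]] : exists k : 'M_(\rank (kermx h), rdegree W),
    [/\ k *m h = 0, forall v : 'rV_(\rank (kermx h)), v *m k = 0 -> v = 0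
      & forall g, g \in G -> submod_repr modK g *m k = k *m W g].
  exists (val_submod 1%:M); split=> [|v|g Gg].
  - by apply/sub_kermxP; apply: val_submodP.
  - by move/eqP; rewrite -val_submodE val_submod_eq0 => /eqP.
  - by rewrite -val_submodE -val_submodJ // mul1mx.
exists (col_mx f k).
- have rh : \rank h = rdegree V.
    apply/eqP; rewrite eqn_leq rank_leq_col /=.
    by rewrite -[X in (X <= _)%N](mxrank1 F) -fh mxrankM_maxr.
  by rewrite /= mxrank_ker rh subnKC // -rh rank_leq_row.
- apply: inj_row_free => /= v; rewrite -[v]hsubmxK mul_row_col => vfk.
  have l0 : lsubmx v = 0.
    have := congr1 (mulmx^~ h) vfk.
    by rewrite /= mulmxDl -!mulmxA kh fh mulmx0 addr0 mulmx1 mul0mx.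
  move: vfk; rewrite l0 mul0mx add0r => /k_inj->.
  by rewrite row_mx0.
- move=> g Gg; rewrite /= mul_block_col !mul0mx addr0 add0r mul_col_mx.
  by rewrite Hf ?k_hom.
Qed.

End EquivariantMaps.

(** * Frobenius reciprocity and the lifting property *)

Section Frobenius.

Variables (F : fieldType) (gT : finGroupType) (G H : {group gT}).
Hypothesis sHG : H \subset G.
Implicit Types (C : representation F G).

Lemma transv_unique g : g \in G ->
  exists2 k : 'I_#|rcosets H G|, (g * (transv k)^-1)%g \in H
    & forall j : 'I_#|rcosets H G|, ((g * (transv j)^-1)%g \in H) = (j == k).
Proof.
move=> Gg; have [k Hk] := transv_ex H Gg; exists k => // j.
apply/idP/eqP=> [Hj | ->] //; apply: transv_inj.
have := groupM (groupVr Hj) Hk.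
by rewrite !invMg invgK !mulgA mulgVK.
Qed.

Lemma sum_transv (V : zmodType) g (A : 'I_#|rcosets H G| -> V) k :
  g \in G -> (g * (transv k)^-1)%g \in H ->
  \sum_j (if (g * (transv j)^-1)%g \in H then A j else 0) = A k.
Proof.
move=> Gg Hk; have [l _ lP] := transv_unique Gg.
have /eqP -> : k == l by rewrite -lP.
by rewrite (bigD1 l) //= lP eqxx big1 ?addr0 // => j /negPf; rewrite lP => ->.
Qed.

Variables (m : nat) (rH : mx_representation F H m).

(** Frobenius reciprocity: the extension of an H-map along w |-> w (x) 1. *)
Definition ind_ext C (f : 'M_(m, rdegree C)) :
    'M_(rdegree (ind_repr sHG rH), rdegree C) :=
  \mxcol_(i < #|rcosets H G|) (f *m C (transv i)).

Lemma ind_ext_hom C (f : 'M_(m, rdegree C)) :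
  (forall h, h \in H -> rH h *m f = f *m C h) -> hom_on G (ind_ext f).
Proof.
move=> Hf g Gg; rewrite /= /ind_mx /ind_ext mul_mxblock_mxrow mxcol_mul.
apply: eq_mxcol => i; have Gi := transvG sHG i.
have Gig := groupM Gi Gg.
have [k Hk _] := transv_unique Gig.
rewrite (eq_bigr (fun j => if (transv i * g * (transv j)^-1)%g \in H
   then rH (transv i * g * (transv j)^-1)%g *m (f *m C (transv j)) else 0)).
  rewrite (sum_transv _ Gig Hk) mulmxA Hf // -!mulmxA -!repr_mxM ?mulgKV //.
    exact: (subsetP sHG).
  exact: transvG.
by move=> j _; case: ifP => // _; rewrite mul0mx.
Qed.

Lemma ind_ext_mul C D (f : 'M_(m, rdegree C)) (d : 'M_(rdegree C, rdegree D)) :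
  hom_on G d -> ind_ext f *m d = ind_ext (f *m d).
Proof.
move=> Hd; rewrite /ind_ext mxcol_mul; apply: eq_mxcol => i.
by rewrite -!mulmxA Hd ?transvG.
Qed.

(** An induced module is generated by its block of the trivial coset, so a
    G-map is determined by an H-map on that block. *)
Lemma ind_extP C (f : 'M_(rdegree (ind_repr sHG rH), rdegree C)) :
  hom_on G f -> exists2 f0 : 'M_(m, rdegree C),
    (forall h, h \in H -> rH h *m f0 = f0 *m C h) & f = ind_ext f0.
Proof.
have [f_ ->] : exists f_ : 'I_#|rcosets H G| -> 'M_(m, rdegree C),
    f = \mxcol_i f_ i by exists (submxcol f); rewrite submxcolK.
move=> {f} Hf; have [o _ _] := transv_unique (group1 G).
have Go := transvG sHG o.
have fE g i j : g \in G -> (transv i * g * (transv j)^-1)%g \in H ->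
    rH (transv i * g * (transv j)^-1)%g *m f_ j = f_ i *m C g.
  move=> Gg Hj; have := Hf g Gg.
  rewrite /= /ind_mx mul_mxblock_mxrow mxcol_mul => /eq_mxcolP/(_ i) <-.
  rewrite (eq_bigr (fun j => if (transv i * g * (transv j)^-1)%g \in H
     then rH (transv i * g * (transv j)^-1)%g *m f_ j else 0)).
    by rewrite (sum_transv _ _ Hj) // groupM ?transvG.
  by move=> l _; case: ifP => // _; rewrite mul0mx.
exists (f_ o *m C (transv o)^-1%g) => [h Hh|].
  have Gh := subsetP sHG h Hh.
  have := fE ((transv o)^-1 * h * transv o)%g o o.
  rewrite !mulgA mulgV mul1g mulgK !groupM ?groupV // => /(_ isT Hh) E.
  by rewrite mulmxA E -!mulmxA -!repr_mxM ?groupM ?groupV // mulgK.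
apply: eq_mxcol => i; have Gi := transvG sHG i.
have := fE ((transv o)^-1 * transv i)%g o i.
rewrite mulgA mulgV mul1g mulgV group1 repr_mx1 mul1mx groupM ?groupV //.
by move=> /(_ isT isT) ->; rewrite -mulmxA -repr_mxM ?groupV.
Qed.

End Frobenius.

Section RelativeProjectivity.

Variables (F : fieldType) (gT : finGroupType) (G : {group gT}).
Variable chi : {set subgroup_of G}.
Implicit Types (P V W B C : representation F G).

(** The lifting property with respect to maps that split over each subgroup in
    chi.  The map f need only take values in the image of d, so that the
    property applies directly to the differentials of a resolution. *)
Definition lifts P : Prop :=
  forall B C (d : 'M_(rdegree B, rdegree C)) (f : 'M_(rdegree P, rdegree C)),
    hom_on G d -> hom_on G f ->
    (forall H, H \in chi -> Defs.splits_over (val H) d) -> (f <= d)%MS ->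
  exists2 e : 'M_(rdegree P, rdegree B), hom_on G e & e *m d = f.

Lemma lifts0 : lifts grepr0.
Proof.
move=> B C d f _ _ _ _; exists 0; first exact: hom_on0.
by rewrite mul0mx [f]flatmx0.
Qed.

Lemma lifts_dadd P1 P2 : lifts P1 -> lifts P2 -> lifts (dadd_grepr P1 P2).
Proof.
move=> L1 L2 B C d f Hd Hf sd.
have [f1 f2] := (hom_on_dadd_l Hf, hom_on_dadd_r Hf).
rewrite -[f](@vsubmxK _ (rdegree P1)) col_mx_sub => /andP[fd1 fd2].
have [e1 He1 E1] := L1 _ _ _ _ Hd f1 sd fd1.
have [e2 He2 E2] := L2 _ _ _ _ Hd f2 sd fd2.
exists (col_mx e1 e2); first by apply/hom_on_col.
by rewrite mul_col_mx E1 E2.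
Qed.

Lemma lifts_retract P W (i : 'M_(rdegree P, rdegree W))
    (p : 'M_(rdegree W, rdegree P)) :
  hom_on G i -> hom_on G p -> i *m p = 1%:M -> lifts W -> lifts P.
Proof.
move=> Hi Hp ip LW B C d f Hd Hf sd fd.
have [|e He E] := LW B C d (p *m f) Hd (hom_onM Hp Hf) sd.
  exact: submx_trans (submxMl _ _) fd.
exists (i *m e); first exact: hom_onM.
by rewrite -mulmxA E mulmxA ip mul1mx.
Qed.

(** By Frobenius reciprocity a map out of the induced module is an H-map, and
    the latter lifts along the H-splitting of d. *)
Lemma lifts_resind V H : H \in chi -> lifts (resind V H).
Proof.
move=> chiH B C d f Hd /ind_extP[f0 Hf0 ->] sd fd.
have [u Hu dud] := sd H chiH.
have {fd} /submxP[x f0E] : (f0 <= d)%MS.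
  have [o _ _] := transv_unique (val H) (group1 G).
  have Go := transvG (valP H) o.
  have /submxP[x /mxcolP/(_ o)] := fd.
  rewrite mxcolK -submxcol_mul => E.
  rewrite -[f0]mulmx1 -(repr_mx1 C) -(mulgV (transv o)) repr_mxM ?groupV //.
  rewrite mulmxA E -mulmxA -Hd ?groupV // mulmxA; exact: submxMl.
exists (ind_ext (valP H) (subg_repr V (valP H)) (f0 *m u)).
  apply: ind_ext_hom => h Hh; rewrite mulmxA Hf0 // -!mulmxA.
  by rewrite Hu.
by rewrite ind_ext_mul // -mulmxA f0E -!mulmxA [d *m _]mulmxA dud.
Qed.

Definition resind_counit V (H : subgroup_of G) :
    'M_(rdegree (resind V H), rdegree V) :=
  ind_ext (valP H) (subg_repr V (valP H)) 1%:M.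

Lemma resind_counit_hom V H : hom_on G (resind_counit V H).
Proof. by apply: ind_ext_hom => h Hh; rewrite mul1mx mulmx1. Qed.

(** Over H the counit is split by v |-> v (x) 1. *)
Lemma resind_counit_split V H :
  exists2 u : 'M_(rdegree V, rdegree (resind V H)),
    hom_on (val H) u & u *m resind_counit V H = 1%:M.
Proof.
pose t := @transv _ G (val H).
exists (\mxrow_j (if (1 * (t j)^-1)%g \in val H then V (t j)^-1%g else 0)).
  move=> h Hh; rewrite mul_mxrow /= /ind_mx mul_mxrow_mxblock.
  have Gh := subsetP (valP H) h Hh; apply: eq_mxrow => j.
  rewrite (eq_bigr (fun i => if (1 * (t i)^-1)%g \in val H then
      V (t i)^-1%g *m (if (t i * h * (t j)^-1)%g \in val H
         then V (t i * h * (t j)^-1)%g else 0) else 0)); last first.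
    by move=> i _; case: ifP => // _; rewrite mul0mx.
  have [o Ho _] := transv_unique (val H) (group1 G).
  rewrite (sum_transv _ (group1 G) Ho).
  have Go := transvG (valP H) o; have Gj := transvG (valP H) j.
  have Ho' : t o \in val H by move: Ho; rewrite mul1g groupV.
  rewrite -mulgA !groupMl //; case: ifP => _; last first.
    by rewrite !mulmx0.
  by rewrite -!repr_mxM ?groupM ?groupV // mulKg.
rewrite /resind_counit /ind_ext mul_mxrow_mxcol.
rewrite (eq_bigr (fun j => if (1 * (t j)^-1)%g \in val H then 1%:M else 0)).
  by have [o Ho _] := transv_unique (val H) (group1 G);
    rewrite (sum_transv _ (group1 G) Ho).
move=> j _; case: ifP => _; last by rewrite mul0mx.
have Gj := transvG (valP H) j.
by rewrite mul1mx -repr_mxM ?groupV // mulVg repr_mx1.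
Qed.

Lemma rel_projective_lifts P : rel_projective chi P -> lifts P.
Proof.
move=> /direct_summandP[i [p [Hi Hp] ip]]; apply: lifts_retract Hi Hp ip _.
apply: (big_ind lifts); [exact: lifts0 | exact: lifts_dadd |].
by move=> H; apply: lifts_resind.
Qed.

Lemma sum_counit_split V (r : seq (subgroup_of G)) :
  exists2 p : 'M_(rdegree (\big[dadd_grepr/grepr0]_(H <- r) resind V H),
                  rdegree V), hom_on G p &
    forall H, H \in r ->
      exists2 u : 'M_(rdegree V, _), hom_on (val H) u & u *m p = 1%:M.
Proof.
elim: r => [|K r [p Hp sp]]; first by exists 0; [apply: hom_on0 |].
rewrite big_cons; set W := \big[_/_]_(H <- r) _ in p Hp sp *.
exists (col_mx (resind_counit V K) p).
  by apply/hom_on_col; split=> //; apply: resind_counit_hom.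
move=> H; rewrite inE => /predU1P[-> | /sp[u Hu up]].
  have [u Hu up] := resind_counit_split V K.
  exists (row_mx u 0); first by apply/hom_on_row; split=> //; apply: hom_on0.
  by rewrite mul_row_col mul0mx addr0.
exists (row_mx 0 u); first by apply/hom_on_row; split=> //; apply: hom_on0.
by rewrite mul_row_col mul0mx add0r.
Qed.

(** The sum of the counits onto P splits over each H in chi; when the identity
    of P lifts through it, P is a summand of its source. *)
Lemma lifts_rel_projective P :
  chi != set0 -> lifts P -> rel_projective chi P.
Proof.
move=> /set0Pn[H0 chiH0] LP; apply/direct_summandP; rewrite -big_filter.
set r := filter _ _; have [p Hp sp] := sum_counit_split P r.
have mem_r H : H \in chi -> H \in r.
  by move=> chiH; rewrite mem_filter chiH mem_index_enum.
have [i Hi ip] : exists2 i : 'M_(rdegree P, _),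
    hom_on G i & i *m p = 1%:M.
  apply: LP Hp (@hom_on1 _ _ _ _ _) _ _ => [H chiH|].
    have [|u Hu up] := sp H; first exact: mem_r.
    by exists u; rewrite // -mulmxA up mulmx1.
  have [|u _ <-] := sp H0; first exact: mem_r.
  exact: submxMl.
by exists i, p.
Qed.

End RelativeProjectivity.

(** * The comparison theorem *)

Section Comparison.

Variables (F : fieldType) (gT : finGroupType) (G : {group gT}).
Variables (chi : {set subgroup_of G}) (M : representation F G).
Implicit Types (Q R : rel_resolution chi M) (N P : representation F G).

(** The resolved module is put in degree 0 and the resolution shifted up by
    one, so that the lifting arguments have no special case at the end. *)
Definition aug_obj Q i := if i is j.+1 then res_obj Q j else M.

Definition aug_d Q i : 'M_(rdegree (aug_obj Q i.+1), rdegree (aug_obj Q i)) :=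
  match i with 0 => res_aug Q | j.+1 => res_d Q j end.

Lemma aug_d_hom Q i : hom_on G (aug_d Q i).
Proof. by case: i => [|i]; [apply: res_aug_hom | apply: res_d_hom]. Qed.

Lemma aug_d_split Q i H : H \in chi -> Defs.splits_over (val H) (aug_d Q i).
Proof. by case: i => [|i] ?; [apply: res_aug_split | apply: res_d_split]. Qed.

Lemma aug_d_exact Q i m (A : 'M_(m, rdegree (aug_obj Q i.+1))) :
  (A *m aug_d Q i == 0) = (A <= aug_d Q i.+1)%MS.
Proof.
rewrite -(sameP sub_kermxP eqP).
by case: i A => [|i] A /=; rewrite (res_exact0, res_exact).
Qed.

Lemma aug_dd Q i : aug_d Q i.+1 *m aug_d Q i = 0.
Proof. by apply/eqP; rewrite aug_d_exact. Qed.

Lemma lifts_aug_obj Q i : lifts chi (aug_obj Q i.+1).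
Proof. exact: rel_projective_lifts (res_proj Q i). Qed.

Lemma lift_cycle Q P i (f : 'M_(rdegree P, rdegree (aug_obj Q i.+1))) :
    lifts chi P -> hom_on G f -> f *m aug_d Q i = 0 ->
  exists2 e : 'M_(rdegree P, rdegree (aug_obj Q i.+2)),
    hom_on G e & e *m aug_d Q i.+1 = f.
Proof.
move=> LP Hf /eqP; rewrite aug_d_exact.
by apply: LP => //; [apply: aug_d_hom | apply: aug_d_split].
Qed.

Lemma lift_aug Q P (f : 'M_(rdegree P, rdegree M)) :
    lifts chi P -> hom_on G f ->
  exists2 e : 'M_(rdegree P, rdegree (aug_obj Q 1)),
    hom_on G e & e *m aug_d Q 0 = f.
Proof.
move=> LP Hf; apply: LP => //; first exact: aug_d_hom.
  exact: aug_d_split.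
exact: submx_full (res_aug_onto Q).
Qed.

(** The comparison theorem, one degree at a time: the components in degrees i
    and i + 1 of chain maps between two resolutions, together with the part of
    a homotopy that contracts the composite in degree i + 1.  Such a square
    suffices to compare the cohomology there, and it extends upwards by the
    lifting property.  There are no coboundaries in cohomological degree 0, so
    the homotopy must not use the augmentation: hence the condition on h0. *)
Lemma comparison Q R i :
  exists (f0 : 'M_(rdegree (aug_obj Q i), rdegree (aug_obj R i)))
         (f1 : 'M_(rdegree (aug_obj Q i.+1), rdegree (aug_obj R i.+1)))
         (g0 : 'M_(rdegree (aug_obj R i), rdegree (aug_obj Q i)))
         (g1 : 'M_(rdegree (aug_obj R i.+1), rdegree (aug_obj Q i.+1)))
         (h0 : 'M_(rdegree (aug_obj Q i), rdegree (aug_obj Q i.+1)))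
         (h1 : 'M_(rdegree (aug_obj Q i.+1), rdegree (aug_obj Q i.+2))),
  [/\ [/\ hom_on G f0, hom_on G f1, hom_on G g0 & hom_on G g1],
      [/\ hom_on G h0, hom_on G h1 & i = 0%N -> h0 = 0],
      f1 *m aug_d R i = aug_d Q i *m f0,
      g1 *m aug_d Q i = aug_d R i *m g0 &
      1%:M - f1 *m g1 = aug_d Q i *m h0 + h1 *m aug_d Q i.+1].
Proof.
elim: i => [|i [f0 [f1 [g0 [g1 [h0 [h1]]]]]]].
  have [f Hf fE] := lift_aug R (lifts_aug_obj (i := 0)) (aug_d_hom Q 0).
  have [g Hg gE] := lift_aug Q (lifts_aug_obj (i := 0)) (aug_d_hom R 0).
  have [||h Hh hE] := lift_cycle (f := 1%:M - f *m g) (lifts_aug_obj (i := 0)).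
  - by apply: hom_onB; [apply: hom_on1 | apply: hom_onM Hg].
  - by rewrite mulmxBl mul1mx -mulmxA gE fE subrr.
  exists 1%:M, f, 1%:M, g, 0, h; rewrite !mulmx1 hE mulmx0 add0r.
  by do !split=> //; (apply: hom_on1 || apply: hom_on0).
case=> [[Hf0 Hf1 Hg0 Hg1] [Hh0 Hh1 _] fE gE hE].
have [||f2 Hf2 f2E] :=
    lift_cycle (Q := R) (f := aug_d Q i.+1 *m f1) (lifts_aug_obj (i := i.+1)).
- exact: hom_onM (aug_d_hom _ _) Hf1.
- by rewrite -mulmxA fE mulmxA aug_dd mul0mx.
have [||g2 Hg2 g2E] :=
    lift_cycle (Q := Q) (f := aug_d R i.+1 *m g1) (lifts_aug_obj (i := i.+1)).
- exact: hom_onM (aug_d_hom _ _) Hg1.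
- by rewrite -mulmxA gE mulmxA aug_dd mul0mx.
have [||h2 Hh2 h2E] := lift_cycle (Q := Q)
    (f := 1%:M - f2 *m g2 - aug_d Q i.+1 *m h1) (lifts_aug_obj (i := i.+1)).
- apply: hom_onB; last exact: hom_onM (aug_d_hom _ _) Hh1.
  by apply: hom_onB; [apply: hom_on1 | apply: hom_onM Hg2].
- rewrite !mulmxBl mul1mx -[f2 *m _ *m _]mulmxA g2E mulmxA f2E -!mulmxA.
  rewrite -{1}[aug_d Q i.+1]mulmx1 -!mulmxBr.
  by rewrite hE addrK mulmxA aug_dd mul0mx.
exists f1, f2, g1, g2, h1, h2; split=> //.
by rewrite h2E [RHS]addrC subrK.
Qed.

(** The last hypothesis says that u induces an injection from Z / B to
    Z' / B'. *)
Lemma leq_dim_quotient (vT wT : vectType F) (u : 'Hom(vT, wT))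
    (B Z : {vspace vT}) (B' Z' : {vspace wT}) :
    (B <= Z)%VS -> (B' <= Z')%VS -> (u @: Z <= Z')%VS ->
    (forall z, z \in Z -> u z \in B' -> z \in B) ->
  (\dim Z - \dim B <= \dim Z' - \dim B')%N.
Proof.
move=> sBZ sBZ' uZ uB; have := dimv_cap_compl Z B.
rewrite (capv_idPr sBZ) => <-; rewrite addKn.
set C := (Z :\: B)%VS.
have sCZ : (C <= Z)%VS by apply: diffvSl.
have CB z : z \in C -> z \in B -> z = 0.
  by move=> Cz Bz; apply/eqP; rewrite -memv0 -(capv_diff Z B) memv_cap Cz.
have uC0 : (C :&: lker u = 0)%VS.
  apply/eqP; rewrite -subv0; apply/subvP=> z; rewrite memv_cap memv_ker memv0.
  case/andP=> Cz /eqP uz0; apply/eqP/CB => //.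
  by apply: uB; rewrite ?uz0 ?mem0v // (subvP sCZ).
have uCB' : (B' :&: u @: C = 0)%VS.
  apply/eqP; rewrite -subv0; apply/subvP=> y; rewrite memv_cap.
  case/andP=> B'y /memv_imgP[z Cz zE]; rewrite memv0 zE (CB z) ?linear0 //.
  by apply: uB; rewrite -?zE // (subvP sCZ).
rewrite -(limg_dim_eq uC0) leq_subRL ?dimvS // -dimv_disjoint_sum //.
by rewrite dimvS // subv_add sBZ' (subv_trans (limgS u sCZ)).
Qed.

(** Composition with g1 is injective on cohomology, because f1 *m g1 is
    homotopic to the identity. *)
Lemma rel_ext_dim_leq Q R N i : (rel_ext_dim Q N i <= rel_ext_dim R N i)%N.
Proof.
have [f0 [f1 [g0 [g1 [h0 [h1]]]]]] := comparison Q R i.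
case=> [[Hf0 Hf1 Hg0 Hg1] [Hh0 Hh1 h00] fE gE hE].
apply: (leq_dim_quotient (u := linfun (mulmx g1)));
  [exact: coboundaries_sub | exact: coboundaries_sub | |].
- apply/subvP=> y /memv_imgP[z]; rewrite memv_cap memv_ker => /andP[Hz zd] ->.
  rewrite memv_cap memv_ker !lfunE /= in zd *; apply/andP; split.
    by apply/homGP; apply: hom_onM Hg1 _; apply/homGP.
  have /submxP[x xE] : (aug_d R i.+1 *m g1 <= aug_d Q i.+1)%MS.
    by rewrite -aug_d_exact -mulmxA gE mulmxA aug_dd mul0mx.
  by rewrite mulmxA -[res_d R i]/(aug_d R i.+1) xE -mulmxA (eqP zd) mulmx0.
move=> z; rewrite memv_cap memv_ker !lfunE /= => /andP[/homGP Hz /eqP zd] uz.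
have zE : z = f1 *m (g1 *m z) + aug_d Q i *m (h0 *m z).
  have := congr1 (mulmx^~ z) hE; rewrite /= mulmxBl mulmxDl mul1mx -!mulmxA.
  by rewrite zd mulmx0 addr0 => <-; rewrite addrC subrK.
case: i => [|i] in f0 f1 g0 g1 h0 h1 Hf0 Hf1 Hg0 Hg1 Hh0 Hh1 h00 fE gE hE
    z Hz zd zE uz *.
  move: uz; rewrite /= memv0 => /eqP uz.
  by rewrite memv0 zE uz h00 // !(mul0mx, mulmx0) addr0.
move: uz => /memv_imgP[y /homGP Hy]; rewrite lfunE /= => uz.
apply/memv_imgP; exists (f0 *m y + h0 *m z).
  by apply/homGP; apply: hom_onD; apply: hom_onM; eassumption.
rewrite lfunE /= mulmxDr {1}zE uz; congr (_ + _).
by rewrite !mulmxA; congr (_ *m _); apply: fE.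
Qed.

Lemma rel_ext_dim_indep Q R N i : rel_ext_dim Q N i = rel_ext_dim R N i.
Proof. by apply/eqP; rewrite eqn_leq !rel_ext_dim_leq. Qed.

End Comparison.

(** * Splicing short exact sequences *)

Section Splicing.

Variables (F : fieldType) (gT : finGroupType) (G : {group gT}).
Variable chi : {set subgroup_of G}.

Definition rel_short_exact (K P M : representation F G)
    (a : 'M_(rdegree K, rdegree P)) (b : 'M_(rdegree P, rdegree M)) : Prop :=
  [/\ hom_on G a /\ hom_on G b, row_free a, row_full b, (kermx b :=: a)%MS
    & forall H, H \in chi ->
        exists2 u : 'M_(rdegree M, rdegree P),
          hom_on (val H) u & u *m b = 1%:M].

Lemma row_full_eq0 (m n p : nat) (A : 'M[F]_(m, n)) (B : 'M_(n, p)) :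
  row_full A -> A *m B = 0 -> B = 0.
Proof. by move=> fA AB; rewrite -[B]mul1mx -(mulVpmx fA) -mulmxA AB mulmx0. Qed.

Lemma row_free_eq0 (m n p : nat) (A : 'M[F]_(m, n)) (B : 'M_(p, m)) :
  row_free A -> B *m A = 0 -> B = 0.
Proof. by move=> fA BA; rewrite -[B]mulmx1 -(mulmxVp fA) mulmxA BA mul0mx. Qed.

(** If u is a section of b over H, then 1 - b u projects onto the kernel of b,
    which is the image of a. *)
Lemma rel_short_exact_retraction K P M a b H :
    @rel_short_exact K P M a b -> H \in chi ->
  exists2 r : 'M_(rdegree P, rdegree K), hom_on (val H) r & a *m r = 1%:M.
Proof.
case=> [[Ha Hb] fa _ ex sp] /[dup] chiH /sp[u Hu ub].
have sHG := valP H.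
have /submxP[r rE] : (1%:M - b *m u <= a)%MS.
  rewrite -ex; apply/sub_kermxP.
  by rewrite mulmxBl mul1mx -mulmxA ub mulmx1 subrr.
have ab : a *m b = 0 by apply/sub_kermxP; rewrite ex.
exists r => [h Hh|].
  apply/eqP; rewrite -subr_eq0; apply/eqP/(row_free_eq0 fa).
  have Gh := subsetP sHG h Hh.
  rewrite mulmxBl -!mulmxA Ha // [r *m (_ *m _)]mulmxA -rE.
  have Hbu : hom_on (val H) (1%:M - b *m u).
    apply: hom_onB (@hom_on1 _ _ _ _ _) _.
    exact: hom_onM (hom_onS sHG Hb) Hu.
  by rewrite Hbu ?subrr.
apply/eqP; rewrite -subr_eq0; apply/eqP/(row_free_eq0 fa).
rewrite mulmxBl mul1mx -mulmxA -rE mulmxBr mulmx1 mulmxA ab mul0mx subr0.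
by rewrite subrr.
Qed.

Variables (K P : nat -> representation F G).
Variable a : forall i, 'M[F]_(rdegree (K i.+1), rdegree (P i)).
Variable b : forall i, 'M[F]_(rdegree (P i), rdegree (K i)).
Hypothesis projP : forall i, rel_projective chi (P i).
Hypothesis exact_ab : forall i, rel_short_exact (a i) (b i).

Definition splice_d i := b i.+1 *m a i.

Lemma splice_ex0 : (kermx (b 0%N) :=: splice_d 0)%MS.
Proof.
have [_ _ _ ex _] := exact_ab 0; have [_ _ fb _ _] := exact_ab 1.
exact: eqmx_trans ex (eqmx_sym (eqmxMfull _ fb)).
Qed.

Lemma splice_ex i : (kermx (splice_d i) :=: splice_d i.+1)%MS.
Proof.
have [_ fa _ _ _] := exact_ab i; have [_ _ _ ex _] := exact_ab i.+1.
have [_ _ fb _ _] := exact_ab i.+2.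
apply: eqmx_trans (eqmx_sym (eqmxMfull _ fb)); apply: eqmx_trans ex.
apply/eqmxP/andP; split; apply/sub_kermxP.
  by apply: (row_free_eq0 fa); rewrite -mulmxA mulmx_ker.
by rewrite mulmxA mulmx_ker mul0mx.
Qed.

Lemma splice_split H :
  H \in chi -> forall i, Defs.splits_over (val H) (splice_d i).
Proof.
move=> chiH i; have [r Hr ar] := rel_short_exact_retraction (exact_ab i) chiH.
have [_ _ _ _ sp] := exact_ab i.+1; have [u Hu ub] := sp H chiH.
exists (r *m u); first exact: hom_onM.
rewrite /splice_d -!mulmxA; congr (_ *m _).
by rewrite mulmxA ar mul1mx mulmxA ub mul1mx.
Qed.

Definition splice : rel_resolution chi (K 0).
Proof.
apply: (@RelResolution _ _ _ _ _ P splice_d (b 0%N)) => [//|i||||||H chiH].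
- have [[Ha _] _ _ _ _] := exact_ab i; have [[_ Hb] _ _ _ _] := exact_ab i.+1.
  exact: hom_onM.
- by have [[]] := exact_ab 0.
- by have [] := exact_ab 0.
- exact: splice_ex0.
- exact: splice_ex.
- move=> H chiH; have [_ _ _ _ /(_ H chiH)[u Hu ub]] := exact_ab 0.
  by exists u; rewrite // -mulmxA ub mulmx1.
- exact: splice_split.
Defined.

(** A cocycle on P i kills the image of a i, so it factors uniquely through
    b i. *)
Lemma splice_cocycles N i : \dim (cocycles splice N i) = \dim (homG (K i) N).
Proof.
have [[Ha Hb] fa fb ex _] := exact_ab i; have [_ _ fb' _ _] := exact_ab i.+1.
have ab : a i *m b i = 0 by apply/sub_kermxP; rewrite ex.
pose u : 'Hom('M[F]_(rdegree (K i), rdegree N),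
              'M[F]_(rdegree (P i), rdegree N)) := linfun (mulmx (b i)).
have ku : (homG (K i) N :&: lker u = 0)%VS.
  apply/eqP; rewrite -subv0; apply/subvP=> f; rewrite memv_cap memv_ker lfunE /=.
  by case/andP=> _ /eqP /(row_full_eq0 fb) ->; rewrite mem0v.
rewrite -(limg_dim_eq ku); congr (\dim _); apply/vspaceP=> f.
apply/idP/memv_imgP => [|[f' Hf' ->]]; last first.
  rewrite memv_cap memv_ker !lfunE /=; apply/andP; split.
    by apply/homGP; apply: hom_onM Hb _; apply/homGP.
  by rewrite /splice_d -mulmxA [a i *m _]mulmxA ab mul0mx mulmx0.
rewrite memv_cap memv_ker lfunE /= => /andP[/homGP Hf /eqP].
rewrite /splice_d -mulmxA => /(row_full_eq0 fb') af.
have fE : f = b i *m (pinvmx (b i) *m f).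
  have /submxP[x xE] : (1%:M - b i *m pinvmx (b i) <= a i)%MS.
    rewrite -ex; apply/sub_kermxP.
    by rewrite mulmxBl mul1mx -mulmxA mulVpmx // mulmx1 subrr.
  apply/eqP; rewrite -subr_eq0 mulmxA -{1}[f]mul1mx -mulmxBl xE.
  by rewrite -mulmxA af mulmx0.
exists (pinvmx (b i) *m f); last by rewrite lfunE.
apply/homGP=> g Gg; apply/eqP; rewrite -subr_eq0; apply/eqP/(row_full_eq0 fb).
rewrite mulmxBr [X in X - _]mulmxA [X in _ - X]mulmxA -Hb // -fE.
by rewrite -mulmxA -fE Hf ?subrr.
Qed.

Lemma splice_ext_dim0 N : rel_ext_dim splice N 0 = \dim (homG (K 0) N).
Proof. by rewrite /rel_ext_dim splice_cocycles dimv0 subn0. Qed.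

Lemma splice_ext_dimS N i : rel_ext_dim splice N i.+1 =
  (\dim (homG (K i.+1) N) - (\dim (homG (P i) N) - \dim (homG (K i) N)))%N.
Proof.
rewrite /rel_ext_dim !splice_cocycles; congr (_ - _)%N.
by rewrite -(limg_ker_dim (coboundary_map splice N i) (homG (P i) N))
  -(splice_cocycles N i) addKn.
Qed.

End Splicing.

(** * Dimension counts *)

Lemma dim_parametrized (F : fieldType) (W T : vectType F) (U : {vspace T})
    (f : W -> T) :
    linear f -> (forall w, f w = 0 -> w = 0) ->
    (forall x, x \in U <-> exists w, x = f w) ->
  \dim U = \dim {:W}.
Proof.
move=> lin_f inj_f UE.
pose fL : {linear W -> T} := HB.pack f (GRing.isLinear.Build F W T _ f lin_f).
have kf : ({:W} :&: lker (linfun fL) = 0)%VS.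
  apply/eqP; rewrite -subv0; apply/subvP=> w; rewrite memv_cap memv_ker lfunE /=.
  by case/andP=> _ /eqP /inj_f ->; rewrite mem0v.
rewrite -(limg_dim_eq kf); congr (\dim _); apply/vspaceP=> x.
apply/idP/memv_imgP => [/UE[w ->] | [w _ ->]].
  by exists w; rewrite ?memvf ?lfunE.
by apply/UE; exists w; rewrite lfunE.
Qed.

Lemma dim_pair (F : fieldType) (V W : vectType F) :
  \dim {:(V * W)%type} = (\dim {:V} + \dim {:W})%N.
Proof. by rewrite !dimvf. Qed.

Lemma leq_dim_hom_rsim (F : fieldType) (gT : finGroupType) (G : {group gT})
    (V V' N N' : representation F G) :
    mx_rsim V V' -> mx_rsim N N' -> (\dim (homG V N) <= \dim (homG V' N'))%N.
Proof.
move=> /mx_rsim_sym[b degV freeb homb] [c _ freec homc].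
have fullb : row_full b.
  by move: freeb; rewrite /row_full /row_free => /eqP->; apply/eqP.
have ku : (homG V N :&: lker (linfun (mulmxr c \o mulmx b)) = 0)%VS.
  apply/eqP; rewrite -subv0; apply/subvP=> f; rewrite memv_cap memv_ker lfunE /=.
  case/andP=> _ /eqP /(row_free_eq0 freec) /(row_full_eq0 fullb) ->.
  exact: mem0v.
rewrite -(limg_dim_eq ku); apply/dimvS/subvP=> x /memv_imgP[f /homGP Hf ->].
rewrite lfunE /=; apply/homGP.
by apply: hom_onM homc; apply: hom_onM homb Hf.
Qed.

Lemma dim_hom_rsim (F : fieldType) (gT : finGroupType) (G : {group gT})
    (V V' N N' : representation F G) :
  mx_rsim V V' -> mx_rsim N N' -> \dim (homG V N) = \dim (homG V' N').
Proof.
move=> simV simN; apply/eqP; rewrite eqn_leq !leq_dim_hom_rsim //;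
  exact: mx_rsim_sym.
Qed.

(** * Modules for the Klein four-group *)

Section KleinModules.

Variables (F : fieldType) (gT : finGroupType) (G : {group gT}) (s t : gT).
Hypotheses (kleinG : klein_four G s t) (char2 : 2%N \in [pchar F]).
Implicit Types (V W C : representation F G).

Local Notation chi := (klein_chi G s t).

Lemma char2_add m n (A : 'M[F]_(m, n)) : A + A = 0.
Proof. by rewrite -mulr2n -scaler_nat (pcharf0 char2) scale0r. Qed.

Lemma char2_opp m n (A : 'M[F]_(m, n)) : - A = A.
Proof. by apply/eqP; rewrite eq_sym -subr_eq0 opprK char2_add. Qed.

Lemma klein_mem : [/\ s \in G, t \in G & (s * t)%g \in G].
Proof. by have [-> _ _] := klein_elts kleinG; rewrite !inE !eqxx !orbT. Qed.

Lemma klein_sq : [/\ (s * s = 1)%g, (t * t = 1)%g & (s * t * (s * t) = 1)%g].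
Proof.
have [_ [ss [tt ts]] _] := klein_elts kleinG; split=> //.
by rewrite mulgA -[(s * t * s)%g]mulgA ts mulgA ss mul1g tt.
Qed.

Lemma klein_chiP H : H \in chi ->
  [\/ val H = <[s]>%G, val H = <[t]>%G | val H = <[s * t]>%G].
Proof.
rewrite inE !inE => /or3P[]/eqP->; by [constructor 1|constructor 2|constructor 3].
Qed.

Fact aug_mx_key : unit. Proof. by []. Qed.

(** For h = s and h = t these are the operators X and Y that generate the
    group algebra.  The lock keeps the distributivity rules from opening the
    difference. *)
Definition aug_mx V (h : gT) : 'M_(rdegree V) :=
  locked_with aug_mx_key (V h - 1%:M).

Lemma aug_mxE V h : aug_mx V h = V h - 1%:M.
Proof. by rewrite /aug_mx unlock. Qed.

Lemma aug_mx_sq V h : h \in G -> (h * h = 1)%g -> aug_mx V h *m aug_mx V h = 0.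
Proof.
move=> Gh hh; rewrite !aug_mxE mulmxBl mulmxBr mul1mx mulmx1 -repr_mxM // hh.
by rewrite repr_mx1 opprB char2_add.
Qed.

Lemma aug_mx_comm V :
  aug_mx V s *m aug_mx V t = aug_mx V t *m aug_mx V s.
Proof.
have [Gs Gt _] := klein_mem; have [_ [_ [_ ts]] _] := klein_elts kleinG.
rewrite !aug_mxE !mulmxBl !mulmxBr !mul1mx !mulmx1 -!repr_mxM // ts.
by rewrite !opprB !addrA addrAC [RHS]addrAC; congr (_ + _); rewrite addrAC.
Qed.

Lemma aug_mx_st V : aug_mx V (s * t)%g =
  aug_mx V s + aug_mx V t + aug_mx V s *m aug_mx V t.
Proof.
have [Gs Gt _] := klein_mem.
rewrite !aug_mxE mulmxBl !mulmxBr !mul1mx !mulmx1 -repr_mxM //.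
by rewrite addrACA subrr addr0 [RHS]addrC addrA subrK.
Qed.

Lemma hom_on_cycleP V W h (f : 'M_(rdegree V, rdegree W)) : h \in G ->
  hom_on <[h]>%g f <-> aug_mx V h *m f = f *m aug_mx W h.
Proof.
move=> Gh; rewrite !aug_mxE mulmxBl mulmxBr mul1mx mulmx1.
split=> [Hf | /addIr Hf]; first by rewrite Hf ?cycle_id.
apply: hom_on_gen; first by rewrite cycle_subG.
by move=> g /set1P->.
Qed.

Lemma aug_mx_hom V W h (f : 'M_(rdegree V, rdegree W)) :
  hom_on G f -> h \in G -> aug_mx V h *m f = f *m aug_mx W h.
Proof. by move=> Hf Gh; rewrite !aug_mxE mulmxBl mulmxBr mul1mx mulmx1 Hf. Qed.

Lemma hom_onP V W (f : 'M_(rdegree V, rdegree W)) :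
  hom_on G f <-> aug_mx V s *m f = f *m aug_mx W s /\
                 aug_mx V t *m f = f *m aug_mx W t.
Proof.
have [Gs Gt _] := klein_mem; have [_ _ genG] := kleinG.
split=> [Hf | []].
  by split; apply/hom_on_cycleP => //; apply: hom_onS Hf; rewrite cycle_subG.
move=> /(hom_on_cycleP _ Gs) Hs /(hom_on_cycleP _ Gt) Ht.
rewrite -genG; apply: hom_on_gen; first by rewrite genG.
by move=> g /set2P[]->; [apply: Hs | apply: Ht]; rewrite cycle_id.
Qed.

(** The module on which s - 1 and t - 1 act by the given matrices: the element
    s^i t^j acts by (1 + X)^i (1 + Y)^j. *)
Definition XY_mx d (X Y : 'M[F]_d) (g : gT) : 'M[F]_d :=
  (if g \in [:: s; s * t]%g then 1%:M + X else 1%:M) *m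
  (if g \in [:: t; s * t]%g then 1%:M + Y else 1%:M).

Definition XY_rel d (X Y : 'M[F]_d) :=
  [/\ X *m X = 0, Y *m Y = 0 & X *m Y = Y *m X].

Lemma XY_mx_gen d (X Y : 'M[F]_d) :
  [/\ XY_mx X Y 1 = 1%:M, XY_mx X Y s = 1%:M + X, XY_mx X Y t = 1%:M + Y
    & XY_mx X Y (s * t)%g = (1%:M + X) *m (1%:M + Y)].
Proof.
have [_ _] := klein_elts kleinG; rewrite /= !inE !negb_or.
case/and4P=> /and3P[n1s n1t n1st] /andP[nst nsst] ntst _.
rewrite /XY_mx !inE !eqxx (negPf n1s) (negPf n1t) (negPf n1st) (negPf nst).
rewrite (negPf nsst) (negPf ntst) [t == s]eq_sym (negPf nst) !orbT /= !mulmx1.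
by rewrite !mul1mx.
Qed.

Lemma XY_mx_repr d (X Y : 'M[F]_d) : XY_rel X Y -> mx_repr G (XY_mx X Y).
Proof.
case=> XX YY XY; have [E [ss [tt ts]] _] := klein_elts kleinG.
have [r1 rs rt rst] := XY_mx_gen X Y.
have XX1 : (1%:M + X) *m (1%:M + X) = 1%:M.
  by rewrite mulmxDl !mulmxDr !mulmx1 !mul1mx XX addr0 -addrA char2_add addr0.
have YY1 : (1%:M + Y) *m (1%:M + Y) = 1%:M.
  by rewrite mulmxDl !mulmxDr !mulmx1 !mul1mx YY addr0 -addrA char2_add addr0.
have YX1 : (1%:M + Y) *m (1%:M + X) = (1%:M + X) *m (1%:M + Y).
  by rewrite !mulmxDl !mulmxDr !mulmx1 !mul1mx XY addrACA.
have tst x : (t * (s * x) = s * (t * x))%g by rewrite !mulgA ts.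
have ttx x : (t * (t * x) = x)%g by rewrite mulgA tt mul1g.
have ssx x : (s * (s * x) = x)%g by rewrite mulgA ss mul1g.
have XXx (Z : 'M[F]_d) : (1%:M + X) *m ((1%:M + X) *m Z) = Z.
  by rewrite mulmxA XX1 mul1mx.
have YYx (Z : 'M[F]_d) : (1%:M + Y) *m ((1%:M + Y) *m Z) = Z.
  by rewrite mulmxA YY1 mul1mx.
have YXx (Z : 'M[F]_d) : (1%:M + Y) *m ((1%:M + X) *m Z) =
    (1%:M + X) *m ((1%:M + Y) *m Z).
  by rewrite !mulmxA YX1.
split=> // x y; rewrite E !inE -!orbA => /or4P[]/eqP-> /or4P[]/eqP->;
  rewrite ?mulg1 ?mul1g -?mulgA ?ts ?tst ?ttx ?ssx ?ss ?tt ?mulg1 ?r1 ?rs ?rt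
          ?rst ?mul1mx ?mulmx1 -?mulmxA ?YX1 ?YXx ?YYx ?XXx ?XX1 ?YY1 ?mulmx1 //.
Qed.

Definition XY_repr d (X Y : 'M[F]_d) (r : XY_rel X Y) : representation F G :=
  Representation (MxRepresentation (XY_mx_repr r)).

Lemma XY_repr_s d (X Y : 'M[F]_d) (r : XY_rel X Y) : aug_mx (XY_repr r) s = X.
Proof.
by rewrite aug_mxE /=; have [_ -> _ _] := XY_mx_gen X Y; rewrite addrC addKr.
Qed.

Lemma XY_repr_t d (X Y : 'M[F]_d) (r : XY_rel X Y) : aug_mx (XY_repr r) t = Y.
Proof.
by rewrite aug_mxE /=; have [_ _ -> _] := XY_mx_gen X Y; rewrite addrC addKr.
Qed.

(** The free module with m generators e, in the order e, Xe, Ye, XYe. *)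
Definition freeX m : 'M[F]_((m + m) + (m + m)) :=
  block_mx (block_mx 0 1%:M 0 0) 0 0 (block_mx 0 1%:M 0 0).

Definition freeY m : 'M[F]_((m + m) + (m + m)) := block_mx 0 1%:M 0 0.

Lemma freeXY_rel m : XY_rel (freeX m) (freeY m).
Proof.
rewrite /freeX /freeY; split;
  rewrite !mulmx_block ?(mulmx0, mul0mx, addr0, add0r).
- by rewrite !block_mx0.
- by rewrite !block_mx0.
- by rewrite mulmx1 mul1mx.
Qed.

Definition free_mod m : representation F G := XY_repr (freeXY_rel m).

Definition free_ext m C (v : 'M_(m, rdegree C)) :
    'M_(rdegree (free_mod m), rdegree C) :=
  col_mx (col_mx v (v *m aug_mx C s))
         (col_mx (v *m aug_mx C t) (v *m aug_mx C s *m aug_mx C t)).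

Lemma aug_mx_X2 C : aug_mx C s *m aug_mx C s = 0.
Proof. by have [[Gs _ _] [ss _ _]] := (klein_mem, klein_sq); apply: aug_mx_sq. Qed.

Lemma aug_mx_Y2 C : aug_mx C t *m aug_mx C t = 0.
Proof. by have [[_ Gt _] [_ tt _]] := (klein_mem, klein_sq); apply: aug_mx_sq. Qed.

Lemma free_ext_hom m C (v : 'M_(m, rdegree C)) : hom_on G (free_ext v).
Proof.
apply/hom_onP; rewrite XY_repr_s XY_repr_t /freeX /freeY /free_ext.
rewrite !mul_block_col !mul_col_mx !(mulmx0, mul0mx, addr0, add0r) !mul1mx.
rewrite -!mulmxA -aug_mx_comm ?aug_mx_X2 ?aug_mx_Y2.
by rewrite [aug_mx C s *m (_ *m _)]mulmxA aug_mx_X2 !(mulmx0, mul0mx, col_mx0).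
Qed.

Lemma free_extP m C (f : 'M_(rdegree (free_mod m), rdegree C)) :
  hom_on G f -> exists v : 'M_(m, rdegree C), f = free_ext v.
Proof.
have [f1 [f2 [f3 [f4 ->]]]] : exists f1 f2 f3 f4 : 'M_(m, rdegree C),
    f = col_mx (col_mx f1 f2) (col_mx f3 f4).
  exists (usubmx (usubmx (f : 'M_((m + m) + (m + m), _)))).
  exists (dsubmx (usubmx (f : 'M_((m + m) + (m + m), _)))).
  exists (usubmx (dsubmx (f : 'M_((m + m) + (m + m), _)))).
  exists (dsubmx (dsubmx (f : 'M_((m + m) + (m + m), _)))).
  by rewrite !vsubmxK.
move=> /hom_onP; rewrite XY_repr_s XY_repr_t /freeX /freeY.
rewrite !mul_block_col !mul_col_mx !(mulmx0, mul0mx, addr0, add0r) !mul1mx.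
case=> /eq_col_mx[/eq_col_mx[E2 _] _] /eq_col_mx[/eq_col_mx[E3 E4] _].
by exists f1; rewrite /free_ext -E2 -E3 E4.
Qed.

Lemma free_ext_mul m C D (v : 'M_(m, rdegree C)) (d : 'M_(rdegree C, rdegree D)) :
  hom_on G d -> free_ext v *m d = free_ext (v *m d).
Proof.
move=> /hom_onP[Xd Yd].
by rewrite /free_ext !mul_col_mx -!mulmxA Yd
           [aug_mx C s *m (_ *m _)]mulmxA Xd -!mulmxA.
Qed.

Lemma lifts_free m : lifts chi (free_mod m).
Proof.
move=> B C d f Hd /free_extP[v ->] _ /submxP[x xE].
have /submxP[y ->] : (v <= d)%MS.
  have : (free_ext v <= d)%MS by rewrite xE submxMl.
  by rewrite /free_ext !col_mx_sub -!andbA => /and4P[].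
by exists (free_ext y); [apply: free_ext_hom | apply: free_ext_mul].
Qed.

(** The permutation module on the cosets of an order-two subgroup: a generator
    c and the sum d of the two cosets, with X c = x d and Y c = y d.  The pairs
    (0, 1), (1, 0), (1, 1) stand for the subgroups generated by s, t and st. *)
Definition ptX (x : bool) : 'M[F]_(1 + 1) := block_mx 0 x%:R%:M 0 0.

Lemma ptXY_rel x y : XY_rel (ptX x) (ptX y).
Proof.
rewrite /ptX; split; rewrite !mulmx_block ?(mulmx0, mul0mx, addr0, add0r);
  by rewrite ?block_mx0.
Qed.

Definition pt x y : representation F G := XY_repr (ptXY_rel x y).

Lemma pt_homP x y C (v w : 'rV_(rdegree C)) :
  @hom_on _ _ _ G (pt x y) C (col_mx v w) <->
  [/\ v *m aug_mx C s = x%:R *: w, v *m aug_mx C t = y%:R *: w,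
      w *m aug_mx C s = 0 & w *m aug_mx C t = 0].
Proof.
apply: iff_trans (hom_onP _) _; rewrite XY_repr_s XY_repr_t.
rewrite /ptX !mul_block_col !mul_col_mx.
rewrite !(mulmx0, mul0mx, addr0, add0r) !mul_scalar_mx.
split=> [[/eq_col_mx[-> ->] /eq_col_mx[-> ->]] // | [-> -> -> ->] //].
Qed.

Lemma pt_s_homP C (v w : 'rV_(rdegree C)) :
  @hom_on _ _ _ G (pt false true) C (col_mx v w) <->
  v *m aug_mx C s = 0 /\ w = v *m aug_mx C t.
Proof.
apply: iff_trans (pt_homP _ _ _ _) _; rewrite scale0r scale1r.
split=> [[vX <-] // | [vX ->]].
by rewrite -!mulmxA -aug_mx_comm aug_mx_Y2 mulmxA vX mul0mx mulmx0.
Qed.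

Lemma pt_t_homP C (v w : 'rV_(rdegree C)) :
  @hom_on _ _ _ G (pt true false) C (col_mx v w) <->
  v *m aug_mx C t = 0 /\ w = v *m aug_mx C s.
Proof.
apply: iff_trans (pt_homP _ _ _ _) _; rewrite scale0r scale1r.
split=> [[<- vY] // | [vY ->]].
by rewrite -!mulmxA aug_mx_comm aug_mx_X2 mulmxA vY mul0mx mulmx0.
Qed.

Lemma pt_st_homP C (v w : 'rV_(rdegree C)) :
  @hom_on _ _ _ G (pt true true) C (col_mx v w) <->
  v *m aug_mx C (s * t)%g = 0 /\ w = v *m aug_mx C s.
Proof.
apply: iff_trans (pt_homP _ _ _ _) _; rewrite scale1r aug_mx_st !mulmxDr.
split=> [[vX vY _ wY] | [vst ->]].
  by rewrite mulmxA vX vY wY addr0 char2_add.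
(* X kills both X and XY, so it turns (X + Y + XY) v = 0 into XY v = 0. *)
have vXY : v *m (aug_mx C s *m aug_mx C t) = 0.
  have := congr1 (mulmx^~ (aug_mx C s)) vst.
  rewrite /= !mulmxDl mul0mx -!mulmxA -aug_mx_comm.
  by rewrite [aug_mx C s *m (_ *m _)]mulmxA aug_mx_X2 mul0mx mulmx0 add0r addr0.
move: vst; rewrite vXY addr0 => /eqP; rewrite addr_eq0 char2_opp => /eqP E.
by rewrite -E -!mulmxA vXY aug_mx_X2 mulmx0.
Qed.

(** An h-fixed vector v in the image of d has the h-fixed preimage v u, where u
    is a generalised inverse of d over the subgroup generated by h. *)
Lemma lifts_pt (x y : bool) h k (H : subgroup_of G) :
    H \in chi -> h \in G -> k \in G -> val H = <[h]>%G ->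
    (forall C (v w : 'rV_(rdegree C)),
       @hom_on _ _ _ G (pt x y) C (col_mx v w) <->
       v *m aug_mx C h = 0 /\ w = v *m aug_mx C k) ->
  lifts chi (pt x y).
Proof.
move=> chiH Gh Gk defH homP B C d f Hd Hf sd fd.
have [u Hu dud] := sd H chiH.
rewrite defH in Hu; move/(hom_on_cycleP _ Gh): Hu => Hu.
have [v [w def_f]] : exists v w : 'rV_(rdegree C), f = col_mx v w.
  exists (usubmx (f : 'M_(1 + 1, _))), (dsubmx (f : 'M_(1 + 1, _))).
  by rewrite vsubmxK.
rewrite def_f in Hf fd *; have [vh wE] := (homP _ _ _).1 Hf.
have /submxP[z vE] : (v <= d)%MS by move: fd; rewrite col_mx_sub => /andP[].
have vud : v *m u *m d = v by rewrite vE -!mulmxA [d *m _]mulmxA dud.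
exists (col_mx (v *m u) (v *m u *m aug_mx B k)).
  by apply/homP; split=> //; rewrite -mulmxA -Hu mulmxA vh mul0mx.
rewrite mul_col_mx vud -mulmxA (aug_mx_hom Hd Gk).
by rewrite [v *m u *m _]mulmxA vud wE.
Qed.

(** * The modules V_m and their relative syzygies *)

(** X and Y as maps from the span of the a's to the span of the b's. *)
Definition S0 m : 'M[F]_(m, m.+1) := \matrix_(i, j) (j == i :> nat)%:R.
Definition S1 m : 'M[F]_(m, m.+1) := \matrix_(i, j) (j == i.+1 :> nat)%:R.

Lemma S0_mul m p (B : 'M[F]_(m.+1, p)) i j :
  (S0 m *m B) i j = B (widen_ord (leqnSn m) i) j.
Proof.
rewrite mxE (bigD1 (widen_ord (leqnSn m) i)) //= !mxE eqxx mul1r big1 ?addr0 //.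
by move=> k; rewrite -val_eqE /= !mxE => /negPf->; rewrite mul0r.
Qed.

Lemma S1_mul m p (B : 'M[F]_(m.+1, p)) i j :
  (S1 m *m B) i j = B (lift ord0 i) j.
Proof.
rewrite mxE (bigD1 (lift ord0 i)) //= !mxE eqxx mul1r big1 ?addr0 //.
by move=> k; rewrite -val_eqE /= !mxE => /negPf->; rewrite mul0r.
Qed.

Lemma mul_S0_widen m p (A : 'M[F]_(p, m)) i j :
  (A *m S0 m) i (widen_ord (leqnSn m) j) = A i j.
Proof.
rewrite mxE (bigD1 j) //= !mxE eqxx mulr1 big1 ?addr0 // => k.
by rewrite -val_eqE /= !mxE eq_sym => /negPf->; rewrite mulr0.
Qed.

Lemma mul_S0_max m p (A : 'M[F]_(p, m)) i : (A *m S0 m) i ord_max = 0.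
Proof. by rewrite mxE big1 // => k _; rewrite mxE gtn_eqF ?mulr0. Qed.

Lemma mul_S1_lift m p (A : 'M[F]_(p, m)) i j :
  (A *m S1 m) i (lift ord0 j) = A i j.
Proof.
rewrite mxE (bigD1 j) //= !mxE eqxx mulr1 big1 ?addr0 // => k.
by rewrite -val_eqE /= !mxE eqSS eq_sym => /negPf->; rewrite mulr0.
Qed.

Lemma mul_S1_0 m p (A : 'M[F]_(p, m)) i : (A *m S1 m) i ord0 = 0.
Proof. by rewrite mxE big1 // => k _; rewrite mxE mulr0. Qed.

Lemma mul_S0 m p (A : 'M[F]_(p, m)) (a : 'I_p -> nat -> F) i (j : 'I_m.+1) :
    (forall i j, A i j = a i j) ->
  (A *m S0 m) i j = if (j < m)%N then a i j else 0.
Proof.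
move=> AE; case: ltnP => [lt_jm | le_mj].
  have -> : j = widen_ord (leqnSn m) (Ordinal lt_jm) by apply: val_inj.
  by rewrite mul_S0_widen AE.
have -> : j = ord_max by apply: val_inj => /=; have := ltn_ord j; lia.
exact: mul_S0_max.
Qed.

Lemma mul_S1 m p (A : 'M[F]_(p, m)) (a : 'I_p -> nat -> F) i (j : 'I_m.+1) :
    (forall i j, A i j = a i j) ->
  (A *m S1 m) i j = if (0 < j)%N then a i j.-1 else 0.
Proof.
move=> AE; case: (unliftP ord0 j) => [k|] ->; last exact: mul_S1_0.
by rewrite mul_S1_lift AE.
Qed.

Definition vneg m : representation F G := Representation (Vneg kleinG char2 m).

Lemma vneg_s m : aug_mx (vneg m) s = block_mx 0 (S0 m) 0 0.
Proof. by rewrite aug_mxE /= (Vneg_mx_s F kleinG) addrC addKr. Qed.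

Lemma vneg_t m : aug_mx (vneg m) t = block_mx 0 (S1 m) 0 0.
Proof. by rewrite aug_mxE /= (Vneg_mx_t F kleinG) addrC addKr. Qed.

Lemma vneg_st m : aug_mx (vneg m) (s * t)%g = block_mx 0 (S0 m + S1 m) 0 0.
Proof.
rewrite aug_mx_st vneg_s vneg_t mulmx_block !(mulmx0, mul0mx, addr0).
by rewrite block_mx0 addr0 add_block_mx !addr0.
Qed.

(** The free module on the a's and the permutation modules of the subgroups
    generated by s, t and st. *)
Definition cover m : representation F G :=
  dadd_grepr (free_mod m)
    (dadd_grepr (pt false true) (dadd_grepr (pt true false) (pt true true))).

Definition cover_pt m (w : 'rV[F]_m.+1) : 'M[F]_(1 + 1, m + m.+1) :=
  col_mx (row_mx 0 w) 0.

(** The generators of the permutation modules go to b_m, b_0 and b_0, which lie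
    outside the images of X, Y and X + Y respectively. *)
Definition cover_map m : 'M[F]_(rdegree (cover m), rdegree (vneg m)) :=
  col_mx (free_ext (row_mx 1%:M 0 : 'M_(m, rdegree (vneg m))))
    (col_mx (cover_pt (delta_mx 0 ord_max))
       (col_mx (cover_pt (delta_mx 0 ord0)) (cover_pt (delta_mx 0 ord0)))).

Lemma cover_pt_hom m x y (w : 'rV[F]_m.+1) :
  @hom_on _ _ _ G (pt x y) (vneg m) (cover_pt w).
Proof.
apply/pt_homP; rewrite vneg_s vneg_t !mul_row_block.
by rewrite !(mulmx0, mul0mx, addr0, scaler0, row_mx0).
Qed.

Lemma cover_map_hom m : hom_on G (cover_map m).
Proof.
apply/hom_on_col; split; first exact: free_ext_hom.
by do ?[apply/hom_on_col; split]; apply: cover_pt_hom.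
Qed.

Lemma free_ext_vneg m : free_ext (row_mx 1%:M 0 : 'M_(m, rdegree (vneg m))) =
  col_mx (col_mx (row_mx 1%:M 0) (row_mx 0 (S0 m))) (col_mx (row_mx 0 (S1 m)) 0).
Proof.
rewrite /free_ext vneg_s vneg_t !mul_row_block.
by rewrite !(mulmx0, mul0mx, addr0, mul1mx, row_mx0).
Qed.

(** The embedding of V_(m+2) into the cover.  Write c_h, d_h for the basis of
    the permutation module of <h>.  If m > 0, the kernel of the cover map contains
    the vectors r_0 = X e_1 + c_t, r_i = Y e_i + X e_(i+1) for 0 < i < m and
    r_m = Y e_m + c_s, which form a chain from d_t to d_s with consecutive links
    Y r_i = X r_(i+1), and the vector r' = c_t + c_st.  The partial sums
    r' + r_0 + ... + r_(k-1), for 0 <= k <= m + 1, again form a single chain;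
    they are the images of the a's.  The matrices below give the images of the
    b's in terms of the XYe, d_s, d_t and d_st, and S0 and S1 recover from them
    the middle layer: the coefficients of c_s, c_t, c_st, and those of Xe and Ye
    after an exchange, because X(Ye) = XYe = Y(Xe). *)
Definition bot_free m : 'M[F]_(m.+3, m) := \matrix_(k, i) (i.+1 < k)%N%:R.
Definition bot_s m : 'cV[F]_m.+3 := \col_k (k == m.+2 :> nat)%:R.
Definition bot_t m : 'cV[F]_m.+3 := \col_k (k == 0 :> nat)%:R.
Definition bot_st m : 'cV[F]_m.+3 := const_mx 1.

Definition syz_pt m (c : 'cV[F]_m.+2) (u : 'cV[F]_m.+3) :
  'M[F]_(m.+2 + m.+3, 1 + 1) := block_mx c 0 0 u.

Definition syz_map m : 'M[F]_(rdegree (vneg m.+2), rdegree (cover m)) :=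
  row_mx (block_mx (row_mx 0 (S1 _ *m bot_free m)) (row_mx (S0 _ *m bot_free m) 0)
                   0 (row_mx 0 (bot_free m)))
    (row_mx (syz_pt (S1 _ *m bot_s m) (bot_s m))
       (row_mx (syz_pt (S0 _ *m bot_t m) (bot_t m))
               (syz_pt (const_mx 1) (bot_st m)))).

Lemma S0_bot_free m (k : 'I_m.+2) (i : 'I_m) :
  (S0 _ *m bot_free m) k i = (i.+1 < k)%N%:R.
Proof. by rewrite S0_mul mxE. Qed.

Lemma S1_bot_free m (k : 'I_m.+2) (i : 'I_m) :
  (S1 _ *m bot_free m) k i = (i < k)%N%:R.
Proof. by rewrite S1_mul mxE. Qed.

Lemma syz_pt_hom m (x y : bool) (c : 'cV_m.+2) (u : 'cV_m.+3) :
    S0 m.+2 *m u = x%:R *: c -> S1 m.+2 *m u = y%:R *: c ->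
  @hom_on _ _ _ G (vneg m.+2) (pt x y) (syz_pt c u).
Proof.
move=> Xu Yu; apply/hom_onP; rewrite vneg_s vneg_t XY_repr_s XY_repr_t /ptX.
rewrite /syz_pt !mulmx_block !(mulmx0, mul0mx, addr0, add0r).
by rewrite Xu Yu -!mul_mx_scalar.
Qed.

Lemma syz_map_hom m : hom_on G (syz_map m).
Proof.
apply/hom_on_row; split.
  apply/hom_onP; rewrite vneg_s vneg_t XY_repr_s XY_repr_t /freeX /freeY.
  rewrite !mulmx_block !mul_row_block !mul_mx_row.
  by rewrite !(mulmx0, mul0mx, addr0, add0r, mulmx1, row_mx0).
do ?[apply/hom_on_row; split]; apply: syz_pt_hom; rewrite ?scale0r ?scale1r //;
  apply/matrixP=> k j; rewrite ?S0_mul ?S1_mul !mxE //=.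
by rewrite ltn_eqF.
Qed.

Lemma char2_bool (a b : bool) : a%:R + b%:R = (a (+) b)%:R :> F.
Proof. by case: a b => -[]; rewrite ?addr0 ?add0r // -natrD (pcharf0 char2). Qed.

Lemma syz_cover m : syz_map m *m cover_map m = 0.
Proof.
rewrite /syz_map /cover_map free_ext_vneg !mul_row_col /syz_pt /cover_pt.
rewrite !mul_block_col !mul_row_col !(mulmx0, mul0mx, addr0, add0r, mul_mx_row).
rewrite !add_col_mx !add_row_mx !addr0.
set A := (X in row_mx 0 X); suff -> : A = 0 by rewrite row_mx0 col_mx0.
apply/matrixP=> k j; rewrite /A mxE [X in X + _]mxE.
rewrite (mul_S0 (a := fun k i => (i < k)%N%:R)); last exact: S1_bot_free.
rewrite (mul_S1 (a := fun k i => (i.+1 < k)%N%:R)); last exact: S0_bot_free.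
have ifb (c b : bool) : (if c then b%:R else 0) = (c && b)%:R :> F by case: c.
rewrite !mxE !big_ord1 S0_mul S1_mul !mxE -[1]/(true%:R) -!val_eqE /= !ifb.
rewrite mul1r -!natrM !mulnb !char2_bool /bump leq0n.
case: k j => k lt_k [j lt_j] /=.
set b := (X in X%:R); suff -> : b = false by [].
by rewrite /b; lia.
Qed.

(** The bottom block of the syzygy embedding is injective: its columns record
    the sums of the last entries of a vector, from any given index on. *)
Lemma bot_inj m (v : 'rV[F]_m.+3) :
    v *m bot_free m = 0 -> v *m bot_s m = 0 -> v *m bot_t m = 0 ->
  v *m bot_st m = 0 -> v = 0.
Proof.
move=> vf vs vt vst; pose tail k := \sum_(l < m.+3 | (k <= l)%N) v 0 l.
have tailS (k : 'I_m.+3) : tail k = v 0 k + tail k.+1.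
  rewrite /tail (bigD1 k) //=; congr (_ + _); apply: eq_bigl => l.
  by rewrite ltn_neqAle andbC eq_sym.
have sum_tail k (B : 'cV[F]_m.+3) :
    v *m B = 0 -> (forall l, B l 0 = (k <= l)%N%:R) -> tail k = 0.
  move=> /matrixP/(_ 0 0); rewrite !mxE => vB BE; rewrite -[RHS]vB /tail.
  rewrite big_mkcond; apply: eq_bigr => l _; rewrite BE.
  by case: leqP; rewrite ?mulr1 ?mulr0.
have tail0 : tail 0%N = 0.
  by apply: (sum_tail _ _ vst) => l; rewrite /bot_st mxE leq0n.
have v0 : v 0 ord0 = 0.
  move: vt => /matrixP/(_ 0 0); rewrite !mxE big_ord_recl mxE mulr1 big1 ?addr0 //.
  by move=> l _; rewrite mxE mulr0.
have tailE k : (k <= m.+2)%N -> tail k = 0.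
  case: k => [|[|k]] // le_k; first by have := tailS ord0; rewrite v0 tail0 add0r.
  have [lt_km | le_mk] := ltnP k m.
    apply: (sum_tail _ (col (Ordinal lt_km) (bot_free m))) => [|l].
      by rewrite colE mulmxA vf mul0mx.
    by rewrite !mxE.
  have -> : k = m by lia.
  apply: (sum_tail _ _ vs) => l; rewrite mxE; congr (nat_of_bool _)%:R.
  by have := ltn_ord l; lia.
have tail_end : tail m.+3 = 0.
  by apply: big1 => l; rewrite leqNgt ltn_ord.
have tail0k k : (k <= m.+3)%N -> tail k = 0.
  by rewrite leq_eqVlt => /predU1P[-> // | /tailE].
clearbody tail; apply/rowP=> k; have := tailS k.
rewrite (tail0k k); last exact: ltnW.
rewrite (tail0k k.+1); last exact: ltn_ord.
by rewrite addr0 mxE => <-.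
Qed.

Lemma syz_map_free m : row_free (syz_map m).
Proof.
apply: inj_row_free => v; rewrite -[v](@hsubmxK _ _ m.+2).
move: (lsubmx v) (rsubmx v) => a b.
rewrite /syz_map !mul_mx_row /syz_pt !mul_row_block !mul_mx_row !mulmx0 !addr0.
rewrite !add0r add_row_mx addr0 add0r => /eqP.
rewrite !row_mx_eq0 => /and4P[/andP[_ /andP[/eqP aY /eqP bZ]]].
case/andP=> _ /eqP b1 /andP[/eqP a2 /eqP b2] /andP[/eqP a3 /eqP b3].
have -> : b = 0 by apply: bot_inj.
have : a *m S0 _ = 0.
  apply: bot_inj; rewrite -mulmxA //; [|].
    suff -> : S0 m.+2 *m bot_s m = 0 by rewrite mulmx0.
    by apply/colP=> k; rewrite S0_mul !mxE ltn_eqF //=.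
  rewrite -[RHS]a3; congr (_ *m _).
  by apply/colP=> k; rewrite S0_mul !mxE.
move=> aS; suff -> : a = 0 by rewrite row_mx0.
apply/rowP=> k; move/matrixP: aS => /(_ 0 (widen_ord (leqnSn _) k)).
by rewrite mul_S0_widen !mxE.
Qed.

Section DirectionSplit.

Variables (m : nat) (h : gT) (S : 'M[F]_(m, m.+1)) (w : 'rV[F]_m.+1).
Hypotheses (Gh : h \in G) (hh : (h * h = 1)%g).
Hypothesis hS : aug_mx (vneg m) h = block_mx 0 S 0 0.
Variables (Q : representation F G) (p : 'M[F]_(rdegree Q, rdegree (vneg m))).
Hypothesis Hp : hom_on G p.
Variables (e : 'M[F]_(m, rdegree Q)) (c : 'rV[F]_(rdegree Q)).
Hypotheses (ep : e *m p = row_mx 1%:M 0) (cp : c *m p = row_mx 0 w).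
Hypothesis ch : c *m aug_mx Q h = 0.
Hypothesis Sw_inj : forall (u : 'rV_m) x, u *m S + x *: w = 0 -> u = 0 /\ x = 0.

(** Over the subgroup generated by h the module is free on the a's plus one
    trivial summand spanned by w, so a section is determined by lifts of the
    a's and an h-fixed lift of w. *)
Lemma direction_split :
  exists2 u : 'M_(rdegree (vneg m), rdegree Q), hom_on <[h]>%g u & u *m p = 1%:M.
Proof.
pose A := col_mx S w.
have fA : row_free A.
  apply: inj_row_free => v; rewrite -[v]hsubmxK mul_row_col.
  rewrite {1}[rsubmx v]mx11_scalar mul_scalar_mx => /Sw_inj[-> x0].
  by rewrite [rsubmx v]mx11_scalar x0 raddf0 row_mx0.
have {fA} [J JA AJ] : exists2 J, J *m A = 1%:M & A *m J = 1%:M.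
  exists (pinvmx A); last exact: mulmxVp.
  by apply: mulVpmx; rewrite /row_full (eqP (fA : _ == _)) addn1.
have [SJ wJ] : S *m J = row_mx 1%:M 0 /\ w *m J = row_mx 0 1%:M.
  by move: AJ; rewrite mul_col_mx scalar_mx_block block_mxEv => /eq_col_mx.
pose b := J *m col_mx (e *m aug_mx Q h) c.
exists (col_mx e b).
  apply/hom_on_cycleP => //; rewrite hS mul_block_col !mul0mx !add0r mul_col_mx.
  rewrite /b !mulmxA SJ mul_row_col mul1mx mul0mx addr0 -mulmxA.
  by rewrite mul_col_mx ch -mulmxA aug_mx_sq // mulmx0 col_mx0 mulmx0.
rewrite mul_col_mx ep /b -mulmxA mul_col_mx cp -mulmxA (aug_mx_hom Hp Gh).
rewrite mulmxA ep hS mul_row_block !(mulmx0, mul0mx, mul1mx, addr0).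
have -> : col_mx (row_mx (0 : 'M_(m, m)) S) (row_mx 0 w) = row_mx 0 A.
  by rewrite -block_mxEv block_mxEh col_mx0.
by rewrite mul_mx_row mulmx0 JA scalar_mx_block block_mxEv.
Qed.

End DirectionSplit.

(** For each of the three subgroups, the vector chosen in the cover completes
    the images of the a's to a basis of the span of the b's. *)
Lemma S0_inj m (u : 'rV_m) x :
  u *m S0 m + x *: delta_mx 0 ord_max = 0 -> u = 0 /\ x = 0.
Proof.
move/rowP=> E; split.
  apply/rowP=> j; have := E (widen_ord (leqnSn m) j).
  have wj : (widen_ord (leqnSn m) j == ord_max) = false.
    by rewrite -val_eqE /= ltn_eqF.
  by rewrite [X in X = _]mxE mul_S0_widen !mxE wj andbF mulr0 addr0.
by have := E ord_max; rewrite [X in X = _]mxE mul_S0_max !mxE !eqxx mulr1 add0r.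
Qed.

Lemma S1_inj m (u : 'rV_m) x :
  u *m S1 m + x *: delta_mx 0 ord0 = 0 -> u = 0 /\ x = 0.
Proof.
move/rowP=> E; split.
  apply/rowP=> j; have := E (lift ord0 j).
  by rewrite [X in X = _]mxE mul_S1_lift !mxE andbF mulr0 addr0.
by have := E ord0; rewrite [X in X = _]mxE mul_S1_0 !mxE !eqxx mulr1 add0r.
Qed.

(** The a's are killed from the last one down. *)
Lemma S01_inj m (u : 'rV_m) x :
  u *m (S0 m + S1 m) + x *: delta_mx 0 ord0 = 0 -> u = 0 /\ x = 0.
Proof.
rewrite mulmxDr; move/rowP=> E.
have step j : (u *m S0 m) 0 (lift ord0 j) = 0 -> u 0 j = 0.
  have := E (lift ord0 j); rewrite [X in X = _]mxE [X in X + _ = _]mxE mul_S1_lift.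
  by rewrite !mxE andbF mulr0 addr0 => + uS; rewrite uS add0r.
have u0 n : forall j : 'I_m, (m <= j + n)%N -> u 0 j = 0.
  elim: n => [|n IHn] j le_m; first by have := ltn_ord j; lia.
  apply: step; have [lt_jm | le_mj] := ltnP j.+1 m.
    have -> : lift ord0 j = widen_ord (leqnSn m) (Ordinal lt_jm) by apply: val_inj.
    by rewrite mul_S0_widen IHn //=; lia.
  have -> : lift ord0 j = ord_max.
    by apply: val_inj; rewrite /= /bump leq0n; have := ltn_ord j; lia.
  exact: mul_S0_max.
have {}u0 : u = 0 by apply/rowP=> j; rewrite (u0 m) ?leq_addl // mxE.
split=> //; have := E ord0.
by rewrite u0 !mul0mx addr0 add0r !mxE !eqxx mulr1.
Qed.

Lemma aug_mx_dadd V W h : h \in G ->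
  aug_mx (dadd_grepr V W) h = block_mx (aug_mx V h) 0 0 (aug_mx W h).
Proof.
move=> Gh; rewrite !aug_mxE /= scalar_mx_block opp_block_mx add_block_mx.
by rewrite !subr0.
Qed.

Lemma pt_fix_s : row_mx 1%:M 0 *m aug_mx (pt false true) s = 0.
Proof.
rewrite XY_repr_s /ptX mul_row_block !(mulmx0, mul0mx, addr0, mul1mx).
by rewrite raddf0 row_mx0.
Qed.

Lemma pt_fix_t : row_mx 1%:M 0 *m aug_mx (pt true false) t = 0.
Proof.
rewrite XY_repr_t /ptX mul_row_block !(mulmx0, mul0mx, addr0, mul1mx).
by rewrite raddf0 row_mx0.
Qed.

Lemma pt_fix_st : row_mx 1%:M 0 *m aug_mx (pt true true) (s * t)%g = 0.
Proof.
rewrite aug_mx_st XY_repr_s XY_repr_t char2_add add0r.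
by rewrite /ptX mulmx_block !(mulmx0, mul0mx, addr0) block_mx0 mulmx0.
Qed.

(** Each summand on the right of the cover supplies the fixed lift that the
    corresponding subgroup needs. *)
Lemma cover_split m H : H \in chi ->
  exists2 u : 'M_(rdegree (vneg m), rdegree (cover m)),
    hom_on (val H) u & u *m cover_map m = 1%:M.
Proof.
have [Gs Gt Gst] := klein_mem; have [ss tt stst] := klein_sq.
pose e : 'M[F]_(m, rdegree (cover m)) :=
  row_mx (row_mx (row_mx 1%:M 0) 0) (0 : 'M_(m, (1 + 1) + ((1 + 1) + (1 + 1)))).
have ep : e *m cover_map m = row_mx 1%:M 0.
  rewrite /e /cover_map free_ext_vneg mul_row_col mul0mx addr0.
  by rewrite !mul_row_col !mul0mx !addr0 mul1mx.
case/klein_chiP=> ->.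
- pose c : 'M[F]_(1, rdegree (cover m)) :=
    row_mx (0 : 'M_(1, (m + m) + (m + m))) (row_mx (row_mx 1%:M 0) 0).
  have cp : c *m cover_map m = row_mx 0 (delta_mx 0 ord_max).
    by rewrite /c /cover_map /cover_pt !mul_row_col !mul0mx !mul1mx !addr0 !add0r.
  have ch : c *m aug_mx (cover m) s = 0.
    rewrite /c !aug_mx_dadd // !mul_row_block !(mul0mx, mulmx0, addr0, add0r).
    by rewrite pt_fix_s !row_mx0.
  apply: (@direction_split m s (S0 m) (delta_mx 0 ord_max) Gs ss (vneg_s m) _ _
    (cover_map_hom m) _ _ ep cp ch (@S0_inj m)).
- pose c : 'M[F]_(1, rdegree (cover m)) :=
    row_mx (0 : 'M_(1, (m + m) + (m + m))) (row_mx 0 (row_mx (row_mx 1%:M 0) 0)).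
  have cp : c *m cover_map m = row_mx 0 (delta_mx 0 ord0).
    by rewrite /c /cover_map /cover_pt !mul_row_col !mul0mx !mul1mx !addr0 !add0r.
  have ch : c *m aug_mx (cover m) t = 0.
    rewrite /c !aug_mx_dadd // !mul_row_block !(mul0mx, mulmx0, addr0, add0r).
    by rewrite pt_fix_t !row_mx0.
  apply: (@direction_split m t (S1 m) (delta_mx 0 ord0) Gt tt (vneg_t m) _ _
    (cover_map_hom m) _ _ ep cp ch (@S1_inj m)).
- pose c : 'M[F]_(1, rdegree (cover m)) :=
    row_mx (0 : 'M_(1, (m + m) + (m + m))) (row_mx 0 (row_mx 0 (row_mx 1%:M 0))).
  have cp : c *m cover_map m = row_mx 0 (delta_mx 0 ord0).
    by rewrite /c /cover_map /cover_pt !mul_row_col !mul0mx !mul1mx !addr0 !add0r.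
  have ch : c *m aug_mx (cover m) (s * t)%g = 0.
    rewrite /c !aug_mx_dadd // !mul_row_block !(mul0mx, mulmx0, addr0, add0r).
    by rewrite pt_fix_st !row_mx0.
  apply: (@direction_split m (s * t)%g (S0 m + S1 m) (delta_mx 0 ord0) Gst stst
    (vneg_st m) _ _
    (cover_map_hom m) _ _ ep cp ch (@S01_inj m)).
Qed.

Lemma klein_chi_ex h : h \in [:: s; t; s * t]%g ->
  exists2 H : subgroup_of G, H \in chi & val H = <[h]>%G.
Proof.
have [Gs Gt Gst] := klein_mem => hE.
have Gh : h \in G by move: hE; rewrite !inE => /or3P[]/eqP->.
have sG : <[h]>%G \subset G by rewrite cycle_subG.
exists (exist _ <[h]>%G sG) => //; rewrite inE.
suff: <[h]>%G \in [:: <[s]>%G; <[t]>%G; <[s * t]>%G] by [].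
by move: hE; rewrite !inE => /or3P[]/eqP->; rewrite eqxx ?orbT.
Qed.

Lemma klein_chi_neq0 : chi != set0.
Proof.
by have [H chiH _] := klein_chi_ex (mem_head s _); apply/set0Pn; exists H.
Qed.

Lemma cover_rel_projective m : rel_projective chi (cover m).
Proof.
have [Gs Gt Gst] := klein_mem.
apply: (lifts_rel_projective klein_chi_neq0).
have [Hs cs ds] := klein_chi_ex (mem_head s _).
have [|Ht ct dt] := @klein_chi_ex t; first by rewrite !inE eqxx orbT.
have [|Hst cst dst] := @klein_chi_ex (s * t)%g; first by rewrite !inE eqxx !orbT.
apply: lifts_dadd (@lifts_free m) _.
apply: lifts_dadd; first exact: lifts_pt cs Gs Gt ds pt_s_homP.
apply: lifts_dadd; first exact: lifts_pt ct Gt Gs dt pt_t_homP.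
exact: lifts_pt cst Gst Gs dst pt_st_homP.
Qed.

(** The composite vanishes and the embedding is injective, so exactness in the
    middle is a count of ranks: (2m+5) + (2m+1) = 4m + 6. *)
Lemma cover_exact m : rel_short_exact chi (syz_map m) (cover_map m).
Proof.
have [H chiH _] := klein_chi_ex (mem_head s _).
have [u _ up] := cover_split m chiH.
have rp : \rank (cover_map m) = (m + m.+1)%N.
  apply/eqP; rewrite eqn_leq rank_leq_col /=.
  by rewrite -[X in (X <= _)%N](mxrank1 F) -up mxrankM_maxr.
split; [by split; [apply: syz_map_hom | apply: cover_map_hom] | exact: syz_map_free
  | by rewrite /row_full rp | | exact: cover_split].
apply: eqmx_sym; apply/eqmxP; rewrite -(geq_leqif (mxrank_leqif_eq _)).
  rewrite mxrank_ker rp (eqP (syz_map_free m)) /=; lia.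
by apply/sub_kermxP; apply: syz_cover.
Qed.

(** * Homomorphisms into V_n *)

Section Toeplitz.

Variables (m n r : nat).
Implicit Types (q : 'rV[F]_r).

Definition coef q k : F := if insub k is Some i then q 0 i else 0.

Lemma coefE q (i : 'I_r) : coef q i = q 0 i.
Proof. by rewrite /coef valK. Qed.

Lemma coef_out q k : (r <= k)%N -> coef q k = 0.
Proof. by move=> le_rk; rewrite /coef insubF // ltnNge le_rk. Qed.

Lemma coef_linear a q q' k : coef (a *: q + q') k = a * coef q k + coef q' k.
Proof. by rewrite /coef; case: insub => [i|]; rewrite ?mxE // mulr0 addr0. Qed.

(** Multiplication by the polynomial with coefficients q, from polynomials of
    degree below p to polynomials of degree below c. *)
Definition toep p c q : 'M[F]_(p, c) :=
  \matrix_(i, j) (if (i <= j)%N then coef q (j - i) else 0).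

Lemma toep_linear p c a q q' :
  toep p c (a *: q + q') = a *: toep p c q + toep p c q'.
Proof.
apply/matrixP=> i j; rewrite !mxE; case: ifP; rewrite ?coef_linear //.
by rewrite mulr0 addr0.
Qed.

End Toeplitz.

Lemma toep_shift m n (q : 'rV[F]_(n.+1 - m)) :
  S0 m *m toep m.+1 n.+1 q = toep m n q *m S0 n /\
  S1 m *m toep m.+1 n.+1 q = toep m n q *m S1 n.
Proof.
split; apply/matrixP=> i j.
  rewrite S0_mul; case: (unliftP ord_max j) => [k|] ->.
    have -> : lift ord_max k = widen_ord (leqnSn n) k.
      by apply: val_inj; rewrite /= /bump leqNgt ltn_ord.
    by rewrite mul_S0_widen !mxE.
  rewrite mul_S0_max mxE /=; case: ifP => // le_in; rewrite coef_out //.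
  by have := ltn_ord i; lia.
rewrite S1_mul; case: (unliftP ord0 j) => [k|] ->.
  by rewrite mul_S1_lift !mxE /= /bump !leq0n !add1n ltnS subSS.
by rewrite mul_S1_0 mxE.
Qed.

(** Compatibility with X and Y makes the map constant along diagonals and zero
    at both ends of the outer ones. *)
Lemma toep_unique m n (A : 'M[F]_(m, n)) (B : 'M[F]_(m.+1, n.+1)) :
    S0 m *m B = A *m S0 n -> S1 m *m B = A *m S1 n ->
  exists q : 'rV_(n.+1 - m), A = toep m n q /\ B = toep m.+1 n.+1 q.
Proof.
move=> E0 E1; pose b j l := B (inord j) (inord l).
have AB (i : 'I_m) (j : 'I_n) : A i j = b i j.
  rewrite -mul_S0_widen -E0 S0_mul /b; congr (B _ _);
    by apply: val_inj; rewrite /= inordK // ltnW ?ltnS.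
have AB1 (i : 'I_m) (j : 'I_n) : A i j = b i.+1 j.+1.
  rewrite -mul_S1_lift -E1 S1_mul /b; congr (B _ _);
    by apply: val_inj; rewrite /= inordK ?ltnS.
have b_diag i j : (i < m)%N -> (j < n)%N -> b i.+1 j.+1 = b i j.
  by move=> lt_i lt_j; rewrite -(AB1 (Ordinal lt_i) (Ordinal lt_j)) AB.
have b_col i : (i < m)%N -> b i.+1 0%N = 0.
  move=> lt_i; rewrite -(mul_S1_0 A (Ordinal lt_i)) -E1 S1_mul /b.
  by congr (B _ _); apply: val_inj; rewrite /= inordK.
have b_row i : (i < m)%N -> b i n = 0.
  move=> lt_i; rewrite -(mul_S0_max A (Ordinal lt_i)) -E0 S0_mul /b.
  by congr (B _ _); apply: val_inj; rewrite /= inordK // ltnW.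
have b_low i j : (i <= m)%N -> (j <= n)%N -> (j < i)%N -> b i j = 0.
  elim: i j => [|i IHi] [|j] // le_i le_j lt_ji; first exact: b_col.
  by rewrite b_diag // IHi // ltnW.
have b_up i j : (i <= m)%N -> (j <= n)%N -> (i <= j)%N -> b i j = b 0%N (j - i)%N.
  elim: i j => [|i IHi] [|j] // le_i le_j le_ij.
  by rewrite b_diag // IHi // ltnW.
have b_end k : (k <= n)%N -> (n.+1 - m <= k)%N -> b 0%N k = 0.
  move=> le_k lt_k; have := b_up (n - k)%N n; rewrite subKn // => <- //; try lia.
  by apply: b_row; lia.
pose q := \row_(k < n.+1 - m) b 0%N k; exists q.
have bE i j : (i <= m)%N -> (j <= n)%N ->
    b i j = if (i <= j)%N then coef q (j - i) else 0.
  move=> le_i le_j; case: leqP => [le_ij | lt_ji]; last exact: b_low.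
  rewrite b_up //; have [lt_k | le_k] := ltnP (j - i) (n.+1 - m).
    by rewrite -[(j - i)%N]/(val (Ordinal lt_k)) coefE mxE.
  by rewrite coef_out // b_end //; lia.
split; apply/matrixP=> i j; rewrite mxE.
  by rewrite -bE ?AB // ltnW.
rewrite -bE; [|exact: (ltn_ord i)|exact: (ltn_ord j)]; rewrite /b.
by congr (B _ _); apply: val_inj; rewrite /= inordK ?ltn_ord.
Qed.

Lemma vneg_homP m n (f : 'M_(rdegree (vneg m), rdegree (vneg n))) :
  hom_on G f <-> exists (c : 'M_(m, n.+1)) (q : 'rV_(n.+1 - m)),
    f = block_mx (toep m n q) c 0 (toep m.+1 n.+1 q).
Proof.
split=> [/hom_onP | [c [q ->]]]; last first.
  apply/hom_onP; rewrite !vneg_s !vneg_t !mulmx_block.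
  rewrite !(mulmx0, mul0mx, addr0, add0r).
  by have [-> ->] := toep_shift q.
have [a [c [d [b ->]]]] : exists a c d b,
    f = block_mx a c d b :> 'M_(m + _, n + _).
  by exists (ulsubmx (f : 'M_(m + _, n + _))), (ursubmx (f : 'M_(m + _, n + _))),
    (dlsubmx (f : 'M_(m + _, n + _))), (drsubmx (f : 'M_(m + _, n + _)));
    rewrite submxK.
rewrite !vneg_s !vneg_t !mulmx_block !(mulmx0, mul0mx, addr0, add0r).
case=> /eq_block_mx[_ E0 _ D0] /eq_block_mx[_ E1 _ _].
have -> : d = 0 by apply/matrixP=> i j; rewrite -mul_S0_widen -D0 !mxE.
by have [q [-> ->]] := toep_unique E0 E1; exists c, q.
Qed.

Lemma dim_hom_vneg m n :
  \dim (homG (vneg m) (vneg n)) = (m * n.+1 + (n.+1 - m))%N.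
Proof.
pose f (w : 'M[F]_(m, n.+1) * 'rV[F]_(n.+1 - m)) :
    'M_(rdegree (vneg m), rdegree (vneg n)) :=
  block_mx (toep m n w.2) w.1 0 (toep m.+1 n.+1 w.2).
rewrite (dim_parametrized (f := f)) ?dim_pair ?dimvf ?dim_matrix.
- by congr (_ + _)%N; apply: mul1n.
- move=> a [c q] [c' q']; rewrite /f /= !toep_linear scale_block_mx add_block_mx.
  by rewrite scaler0 addr0.
- move=> [c q] /eqP; rewrite /f /= block_mx_eq0 => /and4P[_ /eqP-> _ /eqP q0].
  congr (_, _); apply/rowP=> k; rewrite -coefE mxE.
  have lt_k : (k < n.+1)%N by have := ltn_ord k; lia.
  by have /matrixP/(_ ord0 (Ordinal lt_k)) := q0; rewrite !mxE subn0.
- move=> x; split=> [/homGP/vneg_homP[c [q ->]] | [[c q] ->]].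
    by exists (c, q).
  by apply/homGP/vneg_homP; exists c, q.
Qed.

(** The h-fixed vectors of V_n are those in the span of the b's, on which k - 1
    vanishes as well. *)
Lemma pt_vneg_hom n (x y : bool) h k S S' w
    (p : 'M_(rdegree (pt x y), rdegree (vneg n))) :
    (forall (u : 'rV_n) z, u *m S + z *: w = 0 -> u = 0 /\ z = 0) ->
    aug_mx (vneg n) h = block_mx 0 S 0 0 ->
    aug_mx (vneg n) k = block_mx 0 S' 0 0 ->
    (forall v v' : 'rV_(rdegree (vneg n)),
       @hom_on _ _ _ G (pt x y) (vneg n) (col_mx v v') <->
       v *m aug_mx (vneg n) h = 0 /\ v' = v *m aug_mx (vneg n) k) ->
  hom_on G p -> exists z, p = cover_pt z.
Proof.
move=> S_inj hS kS' homP.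
have [v1 [v2 [u ->]]] : exists v1 v2 u,
    p = col_mx (row_mx v1 v2) u :> 'M_(1 + 1, n + n.+1).
  exists (lsubmx (usubmx (p : 'M_(1 + 1, n + _)))).
  exists (rsubmx (usubmx (p : 'M_(1 + 1, n + _)))).
  by exists (dsubmx (p : 'M_(1 + 1, n + _))); rewrite hsubmxK vsubmxK.
case/homP; rewrite hS kS' !mul_row_block !(mulmx0, addr0, add0r).
move/eqP; rewrite row_mx_eq0 => /andP[_ /eqP vS] ->.
have [|-> _] := S_inj v1 0; first by rewrite vS scale0r addr0.
by exists v2; rewrite /cover_pt mul0mx row_mx0.
Qed.

Lemma cover_homP m n (f : 'M_(rdegree (cover m), rdegree (vneg n))) :
  hom_on G f <-> exists (v : 'M_(m, rdegree (vneg n))) (x y z : 'rV_n.+1),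
    f = col_mx (free_ext v)
          (col_mx (cover_pt x) (col_mx (cover_pt y) (cover_pt z))).
Proof.
split=> [Hf | [v [x [y [z ->]]]]]; last first.
  apply/hom_on_col; split; first exact: free_ext_hom.
  by do ?[apply/hom_on_col; split]; apply: cover_pt_hom.
have [v Ev] := free_extP (hom_on_dadd_l Hf).
have Hf1 := hom_on_dadd_r Hf.
have [x Ex] := pt_vneg_hom (@S0_inj n) (vneg_s n)
   (vneg_t n) (@pt_s_homP (vneg n)) (hom_on_dadd_l Hf1).
have Hf2 := hom_on_dadd_r Hf1.
have [y Ey] := pt_vneg_hom (@S1_inj n) (vneg_t n)
   (vneg_s n) (@pt_t_homP (vneg n)) (hom_on_dadd_l Hf2).
have [z Ez] := pt_vneg_hom (@S01_inj n) (vneg_st n)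
   (vneg_s n) (@pt_st_homP (vneg n)) (hom_on_dadd_r Hf2).
exists v, x, y, z; rewrite -Ev -Ex -Ey -Ez.
by rewrite !vsubmxK.
Qed.

Lemma dim_hom_cover m n :
  \dim (homG (cover m) (vneg n)) = (m * (n + n.+1) + 3 * n.+1)%N.
Proof.
pose f (w : 'M[F]_(m, n + n.+1) * ('rV[F]_n.+1 * ('rV[F]_n.+1 * 'rV[F]_n.+1))) :
    'M_(rdegree (cover m), rdegree (vneg n)) :=
  col_mx (free_ext (w.1 : 'M_(m, rdegree (vneg n))))
    (col_mx (cover_pt w.2.1) (col_mx (cover_pt w.2.2.1) (cover_pt w.2.2.2))).
rewrite (dim_parametrized (f := f)) ?dim_pair ?dimvf ?dim_matrix.
- by congr (_ + _)%N; rewrite (mul1n _ : (1%N * n.+1)%R = _) !mulSn mul0n addn0.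
- have free_lin a (v v' : 'M_(m, rdegree (vneg n))) :
      free_ext (a *: v + v') = a *: free_ext v + free_ext v'.
    by rewrite /free_ext !mulmxDl -!scalemxAl !scale_col_mx !add_col_mx.
  have pt_lin a (v v' : 'rV_n.+1) :
      cover_pt (a *: v + v') = a *: cover_pt v + cover_pt v'.
    rewrite /cover_pt scale_col_mx scale_row_mx add_col_mx add_row_mx.
    by rewrite !scaler0 !addr0.
  move=> a [v [x [y z]]] [v' [x' [y' z']]].
  by rewrite /f /= free_lin !pt_lin !scale_col_mx !add_col_mx.
- move=> [v [x [y z]]] /eqP.
  rewrite /f /free_ext /cover_pt /= !col_mx_eq0 !row_mx_eq0.
  case/andP=> /andP[/andP[/eqP-> _] _].
  case/and3P=> /andP[/andP[_ /eqP->] _] /andP[/andP[_ /eqP->] _].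
  by case/andP=> /andP[_ /eqP->].
- move=> g; split=> [/homGP/cover_homP[v [x [y [z ->]]]] | [[v [x [y z]]] ->]].
    by exists (v, (x, (y, z))).
  by apply/homGP/cover_homP; exists v, x, y, z.
Qed.

(** * The resolution of the trivial module *)

Lemma vneg0E g : vneg 0 g = 1%:M.
Proof.
have Z (A : 'M[F]_(0, 1)) : block_mx 0 A 0 0 = 0 :> 'M_(0 + 1).
  by rewrite [A]flatmx0 block_mx0.
by rewrite /= /Vneg_mx /VnegX /VnegY !Z !addr0 !if_same mulmx1.
Qed.

(** The case i = 0 is the trivial module itself, which V_0 equals up to the
    form of its matrices. *)
Definition syzygy i : representation F G :=
  if i is j.+1 then vneg j.+1.*2 else triv_repr F G.

Definition syzygy_map i :
    'M[F]_(rdegree (syzygy i.+1), rdegree (cover i.*2)) := syz_map i.*2.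

Definition syzygy_cover i : 'M[F]_(rdegree (cover i.*2), rdegree (syzygy i)) :=
  match i with 0 => cover_map 0 | j.+1 => cover_map j.+1.*2 end.

Lemma hom_to_triv (A : {set gT}) V (f : 'M[F]_(rdegree V, 1)) :
  @hom_on _ _ _ A V (vneg 0) f -> @hom_on _ _ _ A V (triv_repr F G) f.
Proof. by move=> Hf g Ag; rewrite (Hf g Ag) vneg0E. Qed.

Lemma hom_from_triv (A : {set gT}) V (f : 'M[F]_(1, rdegree V)) :
  @hom_on _ _ _ A (vneg 0) V f -> @hom_on _ _ _ A (triv_repr F G) V f.
Proof. by move=> Hf g Ag; rewrite -(Hf g Ag) vneg0E. Qed.

Lemma syzygy_exact i : rel_short_exact chi (syzygy_map i) (syzygy_cover i).
Proof.
case: i => [|i]; last exact: cover_exact.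
have [[Ha Hb] fa fb ex sp] := cover_exact 0.
split=> //; first by split; last exact: hom_to_triv.
by move=> H /sp[u Hu ub]; exists u => //; apply: hom_from_triv.
Qed.

Definition klein_resolution : rel_resolution chi (triv_repr F G) :=
  splice (fun i => cover_rel_projective i.*2) syzygy_exact.

Lemma syzygy_rsim i : mx_rsim (syzygy i) (vneg i.*2).
Proof.
case: i => [|i]; last exact: mx_rsim_refl.
exists (1%:M : 'M_1) => // [|g Gg]; first by rewrite row_free_unit unitmx1.
by rewrite [LHS]mulmx1 [X in _ = _ *m X]vneg0E mulmx1.
Qed.

Lemma klein_ext_dim n (N : representation F G) i : mx_rsim N (vneg n) ->
  rel_ext_dim klein_resolution N i =
    (if (2 * i <= n)%N then n + 1 - 2 * i else 2 * i - (n + 3))%N.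
Proof.
move=> simN.
have dimK j : \dim (homG (syzygy j) N) = (j.*2 * n.+1 + (n.+1 - j.*2))%N.
  by rewrite (dim_hom_rsim (syzygy_rsim j) simN) dim_hom_vneg.
have dimP j : \dim (homG (cover j) N) = (j * (n + n.+1) + 3 * n.+1)%N.
  by rewrite (dim_hom_rsim (mx_rsim_refl _) simN) dim_hom_cover.
case: i => [|i]; first by rewrite splice_ext_dim0 dimK /=; lia.
rewrite splice_ext_dimS !dimK dimP -!muln2.
case: ifP; nia.
Qed.

End KleinModules.

Theorem proposition22 (F : fieldType) (gT : finGroupType) (G : {group gT})
    (s t : gT) (kleinG : klein_four G s t) (char2 : 2%N \in [pchar F])
    (n : nat) (n_ge1 : (1 <= n)%N)
    (N : representation F G) (isoN : mx_rsim N (Vneg kleinG char2 n)) :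
  inhabited (rel_resolution (klein_chi G s t) (triv_repr F G)) /\
  forall (Q : rel_resolution (klein_chi G s t) (triv_repr F G)) (i : nat),
    rel_ext_dim Q N i =
      (if (2 * i <= n)%N then n + 1 - 2 * i else 2 * i - (n + 3))%N.
Proof.
split=> [|Q i]; first exact: inhabits (klein_resolution kleinG char2).
rewrite (rel_ext_dim_indep Q (klein_resolution kleinG char2)).
exact: klein_ext_dim isoN.
Qed.
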